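(* The homogeneous Bethe subalgebra $\mathcal{A}^S_n\subset\mathbb{C}[\mathfrak{S}_n]$ is generated by $\gamma_n$ and the local charges $I^{[n]}_1,\dots,I^{[n]}_{n-2}$.
   Context: $\mathfrak{S}_n$ is the symmetric group; $\sigma_{a,b}$ is the transposition of $a$ and $b$; permutations are multiplied as functions (right factor acts first). $A^{[m]}=\frac1{m!}\sum_{\sigma\in\mathfrak{S}_m}\mathrm{sign}(\sigma)\,\sigma$. We view $\mathfrak{S}_n\subset\mathfrak{S}_{n+m}$ as the permutations fixing $n+1,\dots,n+m$, and $\vartheta_m:\mathbb{C}[\mathfrak{S}_m]\to\mathbb{C}[\mathfrak{S}_{n+m}]$ is the embedding induced by $i\mapsto n+i$. For $p\in\mathbb{C}$ the linear map $\mathrm{Tr}^{(p)}_m:\mathbb{C}[\mathfrak{S}_{n+m}]\to\mathbb{C}[\mathfrak{S}_n]$ is defined as follows: for $\sigma\in\mathfrak{S}_{n+m}$ written as a product of disjoint cycles, delete all symbols $>n$ and read the result as $\tau\in\mathfrak{S}_n$; let $c(\sigma)$, $c(\tau)$ be the numbers of orbits of $\sigma$ on $\{1,\dots,n+m\}$ and of $\tau$ on $\{1,\dots,n\}$; then $\mathrm{Tr}^{(p)}_m(\sigma)=p^{c(\sigma)-c(\tau)}\tau$ (with $p^0=1$). It is applied coefficientwise to polynomials in $u$. For $m\ge1$ put (parameters $\hbar=1$, $z_1=\dots=z_n=0$) $$T^{[n]}_m(u;p)=\mathrm{Tr}^{(p)}_m\Bigl(\vartheta_m(A^{[m]})\bigl(u+\sum_{i=1}^m\sigma_{n,n+i}\bigr)\cdots\bigl(u+\sum_{i=1}^m\sigma_{1,n+i}\bigr)\Bigr)=\sum_{i=0}^nT^{[n]}_{m,i}(p)u^{n-i}.$$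 $\mathcal{A}^S_n$ is the unital subalgebra of $\mathbb{C}[\mathfrak{S}_n]$ generated by all $T^{[n]}_{m,i}(p)$, $m=1,\dots,n-1$, $i=1,\dots,n$, for a given $p$; it is commutative and does not depend on $p$. Set $G^{[n]}_k=\sum_{1\le i_1<\dots<i_k\le n}\sigma_{i_1,i_2}\sigma_{i_2,i_3}\cdots\sigma_{i_{k-1},i_k}$ for $k=2,\dots,n$ (these pairwise commute), $S^{[n]}_1(u)=n\,u^{n-1}+\sum_{k=2}^nG^{[n]}_k\,u^{n-k}$ and $\gamma_n=\sigma_{1,2}\sigma_{2,3}\cdots\sigma_{n-1,n}=G^{[n]}_n$. The power series $\gamma_n^{-1}S^{[n]}_1(u)$ has constant term $1$ (for $n\ge 2$), and the local charges $I^{[n]}_k$ are defined by $\log\bigl(\gamma_n^{-1}S^{[n]}_1(u)\bigr)=\sum_{k=1}^\infty I^{[n]}_k\,u^k$. *)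

(* Defs.v *)
From HB Require Import structures.
From mathcomp Require Import all_boot all_algebra all_fingroup all_field.
From mathcomp Require Export reals complex.

Set Implicit Arguments.
Unset Strict Implicit.
Unset Printing Implicit Defensive.

Import GRing.Theory.
Local Open Scope ring_scope.

(* The group algebra F[S_n], as functions 'S_n -> F under convolution. Its
   product is composition of permutations as functions, the right factor acting
   first (see galg_basisM and galg_basis_comp); MathComp's group law on 'S_n is
   the opposite one, (s * t)%g i = t (s i). *)
Definition galg (F : fieldType) (n : nat) : Type := {ffun 'S_n -> F^o}.

HB.instance Definition _ (F : fieldType) (n : nat) :=
  Vector.copy (galg F n) {ffun 'S_n -> F^o}.

Section GroupAlgebra.
Variables (F : fieldType) (n : nat).
Implicit Types (x y z : galg F n) (s t : 'S_n).

Definition galg_basis s : galg F n := [ffun t => (t == s)%:R].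

Definition galg_mul x y : galg F n :=
  [ffun s => \sum_(t : 'S_n) x t * y (s * t^-1)%g].

Fact galg_mulA : associative galg_mul.
Proof.
move=> x y z; apply/ffunP=> s; rewrite !ffunE.
under eq_bigr => t _ do rewrite ffunE mulr_sumr.
under [RHS]eq_bigr => t _ do rewrite ffunE mulr_suml.
rewrite [RHS]exchange_big /=; apply: eq_bigr => t _.
rewrite [RHS](reindex_inj (mulIg t)) /=; apply: eq_bigr => r _.
by rewrite mulgK invMg mulgA mulrA.
Qed.

Fact galg_mul1l : left_id (galg_basis 1%g) galg_mul.
Proof.
move=> x; apply/ffunP=> s; rewrite ffunE (bigD1 1%g) //= big1 => [|t /negPf t1].
  by rewrite ffunE eqxx mul1r invg1 mulg1 addr0.
by rewrite ffunE t1 mul0r.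
Qed.

Fact galg_mul1r : right_id (galg_basis 1%g) galg_mul.
Proof.
move=> x; apply/ffunP=> s; rewrite ffunE (bigD1 s) //= big1 => [|t ts].
  by rewrite ffunE mulgV eqxx mulr1 addr0.
rewrite ffunE -eq_mulgV1 eq_sym (negPf ts) mulr0 //.
Qed.

Fact galg_mulDl : left_distributive galg_mul +%R.
Proof.
move=> x y z; apply/ffunP=> s; rewrite !ffunE -big_split /=.
by apply: eq_bigr => t _; rewrite ffunE mulrDl.
Qed.

Fact galg_mulDr : right_distributive galg_mul +%R.
Proof.
move=> x y z; apply/ffunP=> s; rewrite !ffunE -big_split /=.
by apply: eq_bigr => t _; rewrite ffunE mulrDr.
Qed.

Fact galg_one_neq0 : galg_basis 1%g != 0.
Proof.
by apply/eqP=> /ffunP/(_ 1%g); rewrite !ffunE eqxx; apply/eqP/oner_neq0.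
Qed.

HB.instance Definition _ := GRing.Zmodule_isNzRing.Build (galg F n)
  galg_mulA galg_mul1l galg_mul1r galg_mulDl galg_mulDr galg_one_neq0.

Fact galg_scaleAl (a : F) x y : a *: (x * y) = (a *: x) * y.
Proof.
apply/ffunP=> s; rewrite !ffunE scaler_sumr.
by apply: eq_bigr => t _; rewrite ffunE -scalerAl.
Qed.

HB.instance Definition _ :=
  GRing.Lmodule_isLalgebra.Build F (galg F n) galg_scaleAl.

Fact galg_scaleAr (a : F) x y : a *: (x * y) = x * (a *: y).
Proof.
apply/ffunP=> s; rewrite !ffunE scaler_sumr.
by apply: eq_bigr => t _; rewrite ffunE -scalerAr.
Qed.

HB.instance Definition _ :=
  GRing.Lalgebra_isAlgebra.Build F (galg F n) galg_scaleAr.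

HB.instance Definition _ := Algebra_isFalgebra.Build F (galg F n).

Lemma galg_basisM s t : galg_basis s * galg_basis t = galg_basis (t * s)%g.
Proof.
apply/ffunP=> r; rewrite ffunE (bigD1 s) //= big1 => [|q /negPf qs].
  by rewrite !ffunE eqxx mul1r addr0 (can2_eq (mulgKV _) (mulgK _)).
by rewrite ffunE qs mul0r.
Qed.

Lemma galg_basis_comp s t (r : 'S_n) :
  (forall i, r i = s (t i)) -> galg_basis s * galg_basis t = galg_basis r.
Proof.
move=> rE; rewrite galg_basisM; congr galg_basis.
by apply/permP=> i; rewrite permM rE.
Qed.

Lemma galg_basis1 : galg_basis 1%g = 1.
Proof. by []. Qed.

(* The linear extension to F[S_n] of a map defined on permutations. *)
Definition galg_ext (V : lmodType F) (f : 'S_n -> V) x : V :=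
  \sum_(s : 'S_n) x s *: f s.

Fact galg_ext_is_linear (V : lmodType F) (f : 'S_n -> V) :
  linear (galg_ext f).
Proof.
move=> a x y; rewrite /galg_ext scaler_sumr -big_split /=.
by apply: eq_bigr => s _; rewrite !ffunE scalerDl scalerA.
Qed.

HB.instance Definition _ (V : lmodType F) (f : 'S_n -> V) :=
  GRing.isLinear.Build F (galg F n) V *:%R (galg_ext f) (galg_ext_is_linear f).

Lemma galg_ext_basis (V : lmodType F) (f : 'S_n -> V) s :
  galg_ext f (galg_basis s) = f s.
Proof.
rewrite /galg_ext (bigD1 s) //= big1 => [|t /negPf ts].
  by rewrite ffunE eqxx scale1r addr0.
by rewrite ffunE ts scale0r.
Qed.

Definition transp (a b : 'I_n) : galg F n := galg_basis (tperm a b).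

End GroupAlgebra.

(* The symbols 1, ..., n of S_(n+m) are the lshift m a, a : 'I_n, and the
   symbols n+1, ..., n+m are the rshift n i, i : 'I_m. *)
Section Embedding.
Variables (F : fieldType) (n m : nat).

Definition shift_fun (s : 'S_m) (k : 'I_(n + m)) : 'I_(n + m) :=
  match split k with inl a => lshift m a | inr i => rshift n (s i) end.

Fact shift_fun_inj s : injective (shift_fun s).
Proof.
apply: (can_inj (g := shift_fun s^-1)) => k; rewrite /shift_fun.
by case: (split_ordP k) => [a ->|i ->];
  rewrite -?/(unsplit (inl _)) -?/(unsplit (inr _)) ?unsplitK //= permK.
Qed.

Definition shift_perm (s : 'S_m) : 'S_(n + m) := perm (@shift_fun_inj s).

Definition theta : galg F m -> galg F (n + m) :=
  galg_ext (fun s => galg_basis F (shift_perm s)).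

Definition keep_low (k : 'I_(n + m)) : option 'I_n :=
  match split k with inl a => Some a | inr _ => None end.

(* The cycle of s through the symbol a, with the symbols > n deleted. *)
Definition low_cycle (s : 'S_(n + m)) (a : 'I_n) : seq 'I_n :=
  pmap keep_low (fingraph.orbit s (lshift m a)).

Definition delete_fun (s : 'S_(n + m)) (a : 'I_n) : 'I_n :=
  next (low_cycle s a) a.

Let keep_lowK : ocancel keep_low (lshift m).
Proof. by move=> k; rewrite /keep_low; case: split_ordP => [a ->|i ->]. Qed.

Let keep_low_lshift a : keep_low (lshift m a) = Some a.
Proof. by rewrite /keep_low -/(unsplit (inl _)) unsplitK. Qed.

Lemma mem_low_cycle s a b :
  (b \in low_cycle s a) = (lshift m b \in fingraph.orbit s (lshift m a)).
Proof.
rewrite /low_cycle mem_pmap; apply/mapP/idP => [[k ks kb]|bs].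
  by have := keep_lowK k; rewrite -kb /= => ->.
by exists (lshift m b); rewrite ?keep_low_lshift.
Qed.

Lemma low_cycle_uniq s a : uniq (low_cycle s a).
Proof. exact: (pmap_uniq keep_lowK (orbit_uniq _ _)). Qed.

Fact delete_fun_inj s : injective (delete_fun s).
Proof.
have sI := @perm_inj _ s.
move=> a b ab; have bs : lshift m b \in fingraph.orbit s (lshift m a).
  rewrite -fconnect_orbit.
  have : delete_fun s a \in low_cycle s a.
    by rewrite mem_next mem_low_cycle in_orbit.
  have : delete_fun s a \in low_cycle s b.
    by rewrite ab mem_next mem_low_cycle in_orbit.
  rewrite !mem_low_cycle -!fconnect_orbit => cb ca.
  by rewrite (connect_trans ca) // fconnect_sym.
have [i orbE] := orbit_rot_cycle (cycle_orbit sI (lshift m a))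
  (orbit_uniq s (lshift m a)) bs.
have [j lowE] : {j | low_cycle s b = rot j (low_cycle s a)}.
  set c := fingraph.orbit s (lshift m a) in orbE *.
  exists (size (pmap keep_low (take i c))).
  by rewrite /low_cycle orbE -/c -{3}(cat_take_drop i c) !pmap_cat rot_size_cat.
move: ab; rewrite /delete_fun lowE next_rot ?low_cycle_uniq //.
exact: (can_inj (prev_next (low_cycle_uniq s a))).
Qed.

Definition delete_perm (s : 'S_(n + m)) : 'S_n := perm (@delete_fun_inj s).

Definition num_orbits k (s : 'S_k) : nat := #|porbits s|.

Definition ptrace (p : F) : galg F (n + m) -> galg F n :=
  galg_ext (fun s =>
    p ^+ (num_orbits s - num_orbits (delete_perm s)) *:
      galg_basis F (delete_perm s)).

End Embedding.

Definition antisymmetrizer (F : fieldType) (m : nat) : galg F m :=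
  (m`!)%:R^-1 *: \sum_(s : 'S_m) (-1) ^+ s *: galg_basis F s.

Section Bethe.
Variables (F : fieldType) (n : nat).

Definition Tfactor (m : nat) (a : 'I_n) : {poly galg F (n + m)} :=
  'X + (\sum_(i < m) transp F (lshift m a) (rshift n i))%:P.

(* T^{[n]}_m(u; p); the factors of the product run from a = n down to a = 1. *)
Definition Tpoly (m : nat) (p : F) : {poly galg F n} :=
  map_poly (ptrace p)
    ((theta n (antisymmetrizer F m))%:P * \prod_(a < n) Tfactor m (rev_ord a)).

(* T^{[n]}_{m,i}(p), the coefficient of u^(n-i), for i <= n. *)
Definition Tcoef (m i : nat) (p : F) : galg F n := (Tpoly m p)`_(n - i).

Definition bethe_algebra (p : F) : {vspace galg F n} :=
  <<1 & [seq Tcoef m i p | m <- iota 1 n.-1, i <- iota 1 n]>>%VS.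

Definition chain (t : seq 'I_n) : galg F n :=
  \prod_(ab <- zip t (behead t)) transp F ab.1 ab.2.

Definition Gsum (k : nat) : galg F n :=
  \sum_(t : k.-tuple 'I_n | sorted ltn [seq val i | i <- t]) chain t.

Definition S1 : {poly galg F n} :=
  'X^(n.-1) *+ n + \sum_(2 <= k < n.+1) (Gsum k)%:P * 'X^(n - k).

Definition gamma : galg F n := chain (enum 'I_n).

Lemma transp_unit (a b : 'I_n) : transp F a b \is a GRing.unit.
Proof.
apply/unitrP; exists (transp F a b).
by rewrite galg_basisM tperm2 galg_basis1.
Qed.

Lemma gamma_unit : gamma \is a GRing.unit.
Proof. by apply: rpred_prod => ab _; apply: transp_unit. Qed.

Lemma Gsum_gamma : Gsum n = gamma.
Proof.
have szn : size (enum 'I_n) == n by rewrite size_enum_ord.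
rewrite /Gsum (bigD1 (Tuple szn)) /=; last first.
  by rewrite val_enum_ord iota_ltn_sorted.
rewrite big1 ?addr0 // => t /andP[t_srt /eqP []]; apply: val_inj => /=.
have tE : [seq val i | i <- t] = [seq val i | i <- enum 'I_n].
  apply: (irr_sorted_eq ltn_trans ltnn t_srt).
    by rewrite val_enum_ord iota_ltn_sorted.
  have t_uniq : uniq t.
    by rewrite -(map_inj_uniq val_inj) (sorted_uniq ltn_trans ltnn t_srt).
  apply: eq_mem_map; apply: (uniq_min_size t_uniq _ _).2 => [i _|].
    by rewrite mem_enum.
  by rewrite size_enum_ord size_tuple.
exact: (inj_map val_inj tE).
Qed.

Lemma coef0_gammaV_S1 : (0 < n)%N -> (gamma^-1%:P * S1)`_0 = 1.
Proof.
rewrite leq_eqVlt => /predU1P[n1|n_gt1]; rewrite coefCM coefD coefMn coefXn.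
  have -> : gamma = 1.
    rewrite /gamma /chain; have := size_enum_ord n; rewrite -[in RHS]n1.
    by case: (enum _) => [|a [|]] //; rewrite big_nil.
  by rewrite big_geq -n1 // coef0 addr0 invr1 mul1r.
have -> : (0 == n.-1)%N = false by case: (n) n_gt1 => [|[]].
rewrite mul0rn add0r big_nat_recr //= subnn expr0 mulr1 Gsum_gamma.
rewrite coefD coefC eqxx coef_sum big_nat big1 => [|k /andP[_ k_ltn]].
  by rewrite add0r mulVr ?gamma_unit.
by rewrite coefCM coefXn eqtype.eq_sym subn_eq0 leqNgt k_ltn mulr0.
Qed.

End Bethe.

(* The coefficient of u^k in log q(u), where q has constant term 1: since
   q - 1 has no constant term, the terms with j > k of
   log q = \sum_(j >= 1) (-1)^(j+1) / j (q - 1)^j do not contribute. *)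
Definition log_coef (F : fieldType) (A : algType F) (q : {poly A}) (k : nat) :
    A :=
  \sum_(1 <= j < k.+1) ((-1) ^+ j.+1 / j%:R : F) *: ((q - 1) ^+ j)`_k.

Lemma coef_exp_eq0 (F : fieldType) (A : algType F) (f : {poly A}) (j k : nat) :
  f`_0 = 0 -> (k < j)%N -> (f ^+ j)`_k = 0.
Proof.
move=> f0; elim: j k => // j IHj k k_j; rewrite exprSr coefM big1 // => i _.
have [ij|ji] := ltnP i j; first by rewrite IHj ?mul0r.
have -> : (k - i)%N = 0%N.
  by apply/eqP; rewrite subn_eq0 (leq_trans _ ji) // -ltnS.
by rewrite f0 mulr0.
Qed.

Lemma log_coef_trunc (F : fieldType) (A : algType F) (q : {poly A})
    (k N : nat) :
  q`_0 = 1 -> (k <= N)%N ->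
  log_coef q k =
    \sum_(1 <= j < N.+1) ((-1) ^+ j.+1 / j%:R : F) *: ((q - 1) ^+ j)`_k.
Proof.
move=> q0 kN; rewrite (@big_cat_nat _ _ _ k.+1 1 N.+1) //= [X in _ + X]big_nat.
rewrite [X in _ + X]big1 ?addr0 // => j /andP[kj _].
by rewrite coef_exp_eq0 ?scaler0 // coefB q0 coefC eqxx subrr.
Qed.

Definition local_charge (F : fieldType) (n k : nat) : galg F n :=
  log_coef ((gamma F n)^-1%:P * S1 F n) k.

(* Main.v *)
Require Import Defs.
From HB Require Import structures.
From mathcomp Require Import all_boot all_algebra all_fingroup all_field.
From mathcomp Require Import reals complex.

Set Implicit Arguments.
Unset Strict Implicit.
Unset Printing Implicit Defensive.

Import GRing.Theory.
Local Open Scope ring_scope.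

(** The polynomial T_1(u; p) equals p u^n + S_1(u) ([Tcoef1]), so the elements
G_1 = n, G_2, ..., G_n = gamma_n lie in the Bethe algebra.
They generate the same algebra as gamma_n and I_1, ..., I_(n-2): writing
S_1 = gamma_n q, the coefficient of u^k in log q is q_k plus a polynomial in
q_1, ..., q_(k-1), so the charges determine q_1, ..., q_(n-2) recursively
([mem_of_log_coef]), and the only other coefficient of S_1 is the scalar n of
u^(n-1).  The inverse of gamma_n lies in every subalgebra containing gamma_n,
by finiteness of the dimension.

It remains to see that T_1 determines all T_m, which is the fusion procedure.
Number the auxiliary symbols 0, 1, ..., m.  For a site a let P be the
transposition of a and 0, and S the sum of the transpositions of a and i for
1 <= i <= m.  Let B and A be the antisymmetrizers on {0, ..., m} and on
{1, ..., m}, so that A is the sum of the orthogonal idempotents B and A - B.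
The factor (u + P)(u - 1 + S) of T_1(u) T_m(u - 1) acts on the image of B as
(u - 1)(u + P + S), which is u - 1 times the factor of T_(m+1)(u), and its left
product with A - B is divisible by u.  Multiplying over the n sites and taking
partial traces gives ([Tpoly_fusion])

  T_1(u) T_m(u - 1) = (u - 1)^n T_(m+1)(u) + u^n V(u).

Since (u - 1)^n is an invertible power series with scalar coefficients, reading
this modulo u^n expresses the coefficients of u^k in T_(m+1), k < n, that is,
all the T_(m+1,i) with i >= 1, through the coefficients of T_1 and T_m, and the
coefficient of u^n in T_m is a scalar.  Induction on m concludes ([Tpoly_mem]).

The left-hand side needs the partial trace to be multiplicative on elements
moving disjoint sets of auxiliary symbols ([ptraceM]).  For this the trace is
written as a composition of maps which delete one symbol each ([ptraceE]); such
a map commutes with multiplication by elements fixing the deleted symbol, and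
multiplicativity follows formally.  The splitting along B and A - B also needs
the trace to be cyclic with respect to permutations of the auxiliary symbols
([ptrace_thetaC]). *)

(** * Products of transpositions in the group algebra *)

Section GroupAlgebraTools.
Variables (F : fieldType) (n : nat).
Implicit Types (x y : galg F n) (s : 'S_n).

Lemma galg_decomp x : x = \sum_s x s *: galg_basis F s.
Proof.
apply/ffunP=> t; rewrite sum_ffunE (bigD1 t) //= big1 ?addr0.
  by rewrite !ffunE eqxx [_ *: _]mulr1.
by move=> s st; rewrite !ffunE eq_sym (negPf st) [_ *: _]mulr0.
Qed.

(** An identity that is linear in an element of the group algebra need only be
checked on permutations. *)
Lemma galg_ind (P : galg F n -> Prop) :
    P 0 -> (forall a x y, P x -> P y -> P (a *: x + y)) ->
    (forall s, P (galg_basis F s)) -> forall x, P x.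
Proof.
move=> P0 PD Pb x; rewrite [x]galg_decomp.
by elim/big_rec: _ => // s y _ Py; apply: PD.
Qed.

Lemma galg_linear_eq (V : lmodType F) (f g : {linear galg F n -> V}) :
  (forall s, f (galg_basis F s) = g (galg_basis F s)) -> f =1 g.
Proof.
move=> fg; elim/galg_ind => [|a x y IHx IHy|//]; first by rewrite !linear0.
by rewrite !linearP /= IHx IHy.
Qed.

Lemma transpC (a b : 'I_n) : transp F a b = transp F b a.
Proof. by rewrite /transp tpermC. Qed.

(** Conjugation moves the labels of a transposition; the commutation
relations below are instances. *)
Lemma galg_basis_transp s (a b : 'I_n) :
  galg_basis F s * transp F a b = transp F (s a) (s b) * galg_basis F s.
Proof. by rewrite !galg_basisM -tpermJ mulKVg. Qed.

Lemma transpM2 (a b : 'I_n) : transp F a b * transp F a b = 1.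
Proof. by rewrite galg_basisM tperm2. Qed.

Lemma transpM_left (a b c : 'I_n) : c != a -> c != b ->
  transp F a b * transp F a c = transp F b c * transp F a b.
Proof. by move=> ca cb; rewrite galg_basis_transp tpermL tpermD // eq_sym. Qed.

Lemma transpM_disjoint (a b c d : 'I_n) : c != a -> c != b -> d != a -> d != b ->
  transp F a b * transp F c d = transp F c d * transp F a b.
Proof.
by move=> ca cb da db; rewrite galg_basis_transp !tpermD // 1?eq_sym.
Qed.

End GroupAlgebraTools.

(** * Embeddings of symmetric groups induced by injections *)

Section Embedding.
Variables (T T' : finType) (f : T -> T').
Hypothesis fI : injective f.
Implicit Types s t : {perm T}.

Definition emb_fun s (y : T') : T' :=
  if [pick x | f x == y] is Some x then f (s x) else y.

Lemma emb_funE s x : emb_fun s (f x) = f (s x).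
Proof.
by rewrite /emb_fun; case: pickP => [z /eqP/fI -> //|/(_ x)]; rewrite eqxx.
Qed.

Lemma emb_fun_out s y : y \notin codom f -> emb_fun s y = y.
Proof.
by rewrite /emb_fun; case: pickP => [z /eqP <- /negP[]|//]; apply: codom_f.
Qed.

Lemma emb_funK s : cancel (emb_fun s) (emb_fun s^-1).
Proof.
move=> y; have [/codomP[x ->]|yf] := boolP (y \in codom f).
  by rewrite !emb_funE permK.
by rewrite !emb_fun_out.
Qed.

Definition perm_emb s : {perm T'} := perm (can_inj (emb_funK s)).

Lemma perm_embE s x : perm_emb s (f x) = f (s x).
Proof. by rewrite permE emb_funE. Qed.

Lemma perm_emb_out s y : y \notin codom f -> perm_emb s y = y.
Proof. by move=> yf; rewrite permE emb_fun_out. Qed.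

(** The universal way of identifying an embedded permutation, used to obtain the
morphism properties and all the comparisons with other constructions. *)
Lemma perm_emb_uniq s (t : {perm T'}) :
    (forall x, t (f x) = f (s x)) -> (forall y, y \notin codom f -> t y = y) ->
  t = perm_emb s.
Proof.
move=> tf t_out; apply/permP=> y.
have [/codomP[x ->]|yf] := boolP (y \in codom f); first by rewrite perm_embE tf.
by rewrite perm_emb_out ?t_out.
Qed.

Lemma perm_embM : {morph perm_emb : s t / (s * t)%g}.
Proof.
move=> s t; apply/esym/perm_emb_uniq => [x|y yf]; rewrite !permM.
  by rewrite !perm_embE.
by rewrite !perm_emb_out.
Qed.

Lemma perm_emb1 : perm_emb 1%g = 1%g.
Proof. by apply/esym/perm_emb_uniq => *; rewrite !perm1. Qed.

Lemma perm_emb_inj : injective perm_emb.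
Proof.
move=> s t st; apply/permP=> x; apply: fI.
by rewrite -!perm_embE st.
Qed.

Lemma perm_emb_tperm a b : perm_emb (tperm a b) = tperm (f a) (f b).
Proof.
apply/esym/perm_emb_uniq => [x|y yf]; first by rewrite inj_tperm.
by rewrite tpermD // eq_sym; apply: contraNneq yf => ->; apply: codom_f.
Qed.

Lemma odd_perm_emb s : perm_emb s = s :> bool.
Proof.
have [ts -> _] := prod_tpermP s.
elim: ts => [|[a b] ts IH]; first by rewrite big_nil perm_emb1 !odd_perm1.
by rewrite big_cons perm_embM perm_emb_tperm !odd_permM IH !odd_tperm (inj_eq fI).
Qed.

End Embedding.

Lemma perm_emb_comp (T T' T'' : finType) (f : T -> T') (g : T' -> T'')
    (h : T -> T'') (fI : injective f) (gI : injective g) (hI : injective h) s :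
  h =1 g \o f -> perm_emb gI (perm_emb fI s) = perm_emb hI s.
Proof.
move=> hE; apply: perm_emb_uniq => [x|y yh]; first by rewrite !hE /= !perm_embE.
have [/codomP[z zE]|yg] := boolP (y \in codom g); last by rewrite perm_emb_out.
rewrite zE perm_embE perm_emb_out //; apply: contra yh => /codomP[x xE].
by rewrite zE xE (_ : g (f x) = h x) ?codom_f // hE.
Qed.

Section GroupAlgebraEmbedding.
Variables (F : fieldType) (k N : nat) (f : 'I_k -> 'I_N).
Hypothesis fI : injective f.

Definition galg_emb : galg F k -> galg F N :=
  galg_ext (fun s => galg_basis F (perm_emb fI s)).

HB.instance Definition _ := GRing.Linear.on galg_emb.

Lemma galg_emb_basis s : galg_emb (galg_basis F s) = galg_basis F (perm_emb fI s).
Proof. exact: galg_ext_basis. Qed.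

Lemma galg_emb_transp a b : galg_emb (transp F a b) = transp F (f a) (f b).
Proof. by rewrite /transp galg_emb_basis perm_emb_tperm. Qed.

Fact galg_emb_monoid : monoid_morphism galg_emb.
Proof.
split=> [|x y]; first by rewrite -galg_basis1 galg_emb_basis perm_emb1.
elim/galg_ind: x => [|a x x' IHx IHx'|s]; first by rewrite !(mul0r, linear0).
  by rewrite mulrDl -scalerAl !linearP /= IHx IHx' mulrDl -scalerAl.
elim/galg_ind: y => [|a y y' IHy IHy'|t]; first by rewrite !(mulr0, linear0).
  by rewrite mulrDr -scalerAr !linearP /= IHy IHy' mulrDr -scalerAr.
by rewrite galg_basisM !galg_emb_basis galg_basisM perm_embM.
Qed.

HB.instance Definition _ :=
  GRing.isMonoidMorphism.Build (galg F k) (galg F N) galg_emb galg_emb_monoid.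

Lemma galg_emb_coef x s : galg_emb x (perm_emb fI s) = x s.
Proof.
elim/galg_ind: x => [|a x y IHx IHy|t]; first by rewrite linear0 !ffunE.
  by rewrite linearP !ffunE IHx IHy.
by rewrite galg_emb_basis !ffunE (inj_eq (@perm_emb_inj _ _ _ fI)).
Qed.

Lemma galg_emb_inj : injective galg_emb.
Proof. by move=> x y xy; apply/ffunP=> s; rewrite -!galg_emb_coef xy. Qed.

End GroupAlgebraEmbedding.

Lemma galg_emb_comp (F : fieldType) k l N (f : 'I_k -> 'I_l) (g : 'I_l -> 'I_N)
    (h : 'I_k -> 'I_N) (fI : injective f) (gI : injective g) (hI : injective h) :
  h =1 g \o f ->
  forall x : galg F k, galg_emb gI (galg_emb fI x) = galg_emb hI x.
Proof.
move=> hE; elim/galg_ind=> [|a x y IHx IHy|s]; first by rewrite !linear0.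
  by rewrite !linearP /= IHx IHy.
by rewrite !galg_emb_basis; congr galg_basis; apply: perm_emb_comp.
Qed.

(** * Deleting one symbol from a permutation *)

Section RemoveSymbol.
Variable N : nat.
Implicit Types (s t : 'S_N) (k x y : 'I_N).

(** In cycle notation, k is deleted from its cycle and becomes a fixed point: s
is modified so that the preimage of k is sent to s k. *)
Definition remove_symbol k s : 'S_N := (s * tperm k (s k))%g.

Lemma remove_symbol_self k s : remove_symbol k s k = k.
Proof. by rewrite permM tpermR. Qed.

Lemma remove_symbol_skip k s x : s x = k -> remove_symbol k s x = s k.
Proof. by move=> sx; rewrite permM sx tpermL. Qed.

Lemma remove_symbol_other k s x :
  x != k -> s x != k -> remove_symbol k s x = s x.
Proof. by move=> xk sxk; rewrite permM tpermD // eq_sym // (inj_eq perm_inj). Qed.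

Lemma remove_symbol_fixed k s x : s x = x -> remove_symbol k s x = x.
Proof.
have [->|xk sx] := eqVneq x k; first by rewrite remove_symbol_self.
by rewrite remove_symbol_other ?sx.
Qed.

(** The step into k and the step out of k are merged into one step of
[remove_symbol k s].  The end points must differ from k
for this merging to make sense. *)
Lemma remove_symbol_path k s x p : x != k -> last x p != k ->
  fpath s x p -> fpath (remove_symbol k s) x [seq y <- p | y != k].
Proof.
have [d] := ubnP (size p); elim: d => // d IHd in x p * => /ltnSE-le_p.
case: p le_p => //= y p le_p xk pk /andP[/eqP sx sp].
have [yk|yk /=] := eqVneq y k; last first.
  by rewrite IHd // andbT remove_symbol_other ?sx.
case: p => [|z p] /= in le_p pk sp *; first by rewrite yk eqxx in pk.
have [/eqP sz {}sp] := andP sp.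
(* Here y = k is dropped, and the next point z exists because the path does not
   end at k. *)
rewrite yk in sx sz; have zk : z != k.
  by rewrite -sz -{2}sx (inj_eq perm_inj) eq_sym.
by rewrite /= zk /= IHd ?(ltnW le_p) // andbT remove_symbol_skip ?sz.
Qed.

Lemma orbit_remove_symbol k s x : x != k ->
  fingraph.orbit (remove_symbol k s) x =
    [seq y <- fingraph.orbit s x | y != k].
Proof.
move=> xk; have sC := cycle_orbit (@perm_inj _ s) x.
have := orbit_uniq s x; rewrite /fingraph.orbit -orderSpred /= in sC *.
set c := traject _ _ _ in sC *; rewrite xk => Uc.
have Uc' : uniq (x :: [seq y <- c | y != k]).
  by have := filter_uniq (predC1 k) (Uc : uniq (x :: c)); rewrite /= xk.
rewrite -[RHS]undup_id // (@undup_cycle_cons _ (remove_symbol k s)) //.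
by have := remove_symbol_path xk _ sC; rewrite last_rcons filter_rcons xk; apply.
Qed.

(** Splitting k off its cycle creates one more orbit, unless k was fixed. *)
Lemma num_orbits_remove_symbol k s :
  num_orbits (remove_symbol k s) = (num_orbits s + (s k != k))%N.
Proof.
(* The same transposition, moved to the other side of s, joins k to its preimage,
   which lies in the same orbit. *)
have sE : remove_symbol k s = (tperm (s^-1 k) k * s)%g.
  by rewrite /remove_symbol -{1}[k](permKV s) -tpermJ mulKVg.
have := porbits_mul_tperm s (s^-1 k)%g k; rewrite /= -sE /num_orbits.
have -> : (s^-1 k)%g \in porbit s k.
  by rewrite porbit_sym; apply/porbitP; exists 1; rewrite expg1 permKV.
by rewrite addn0 (can2_eq (permKV s) (permK s)) eq_sym.
Qed.

End RemoveSymbol.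

Lemma num_orbits1 N : num_orbits (1%g : 'S_N) = N.
Proof.
rewrite /num_orbits card_imset ?card_ord // => x y /eqP.
by rewrite eq_porbit_mem porbit.unlock cycle1 imset_set1 /aperm perm1 inE => /eqP.
Qed.

(** Both sides change in the same way when s is multiplied by a transposition, and
they agree at the identity. *)
Lemma num_orbits_emb k N (f : 'I_k -> 'I_N) (fI : injective f) s :
  (num_orbits (perm_emb fI s) + k = num_orbits s + N)%N.
Proof.
have [ts -> _] := prod_tpermP s.
elim: ts => [|[a b] ts] /=.
  by rewrite big_nil perm_emb1 !num_orbits1 addnC.
rewrite big_cons perm_embM perm_emb_tperm /=; move: (\prod_(_ <- _) _)%g => t IH.
have embX i : (perm_emb fI t ^+ i)%g = perm_emb fI (t ^+ i)%g.
  by elim: i => [|i IHi]; rewrite ?expg0 ?perm_emb1 // !expgS IHi perm_embM.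
have orbE : (f a \in porbit (perm_emb fI t) (f b)) = (a \in porbit t b).
  apply/porbitP/porbitP=> -[i iE]; exists i.
    by apply/fI; rewrite iE embX perm_embE.
  by rewrite embX perm_embE iE.
have := porbits_mul_tperm t a b.
have := porbits_mul_tperm (perm_emb fI t) (f a) (f b).
rewrite /= orbE (inj_eq fI) -!/(num_orbits _) => H1 H2.
apply: (@addIn ((a \notin porbit t b).*2)).
by rewrite addnAC H1 [RHS]addnAC H2 addnAC IH addnAC.
Qed.

Section SymbolTrace.
Variables (F : fieldType) (N : nat) (p : F).
Implicit Types (x y : galg F N) (k : 'I_N) (ks : seq 'I_N).

(** The partial trace over the single symbol k.  Its values stay in the same group
algebra, so that the traces over several symbols are literally compositions. *)
Definition symbol_trace k : galg F N -> galg F N :=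
  galg_ext (fun s => p ^+ (s k == k) *: galg_basis F (remove_symbol k s)).

HB.instance Definition _ k := GRing.Linear.on (symbol_trace k).

Definition symbols_trace ks x := foldr symbol_trace x ks.

Fact symbols_trace_is_linear ks : linear (symbols_trace ks).
Proof. by move=> a x y; elim: ks => //= k ks ->; rewrite linearP. Qed.

HB.instance Definition _ ks :=
  GRing.isLinear.Build F (galg F N) (galg F N) *:%R (symbols_trace ks)
    (symbols_trace_is_linear ks).

Lemma symbol_trace_basis k s :
  symbol_trace k (galg_basis F s) =
    p ^+ (s k == k) *: galg_basis F (remove_symbol k s).
Proof. exact: galg_ext_basis. Qed.

Section Bimodule.
Variables (l : nat) (f : 'I_l -> 'I_N).
Hypothesis fI : injective f.

(** Multiplication by a permutation fixing k does not interfere with the deletion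
of k, because it conjugates the transposition that performs it.
This bimodule property is what makes partial traces multiplicative. *)
Lemma symbol_trace_mull k (x : galg F l) y :
    k \notin codom f ->
  symbol_trace k (galg_emb fI x * y) = galg_emb fI x * symbol_trace k y.
Proof.
move=> kf; elim/galg_ind: x => [|a x x' IHx IHx'|s].
- by rewrite !(mul0r, linear0).
- by rewrite linearP /= !mulrDl -!scalerAl linearP /= IHx IHx'.
elim/galg_ind: y => [|a y y' IHy IHy'|t]; first by rewrite !(mulr0, linear0).
  by rewrite mulrDr -scalerAr !linearP /= IHy IHy' mulrDr -scalerAr.
rewrite galg_emb_basis galg_basisM !symbol_trace_basis -scalerAr galg_basisM.
have sk := perm_emb_out fI s kf; set s' := perm_emb fI s in sk *.
have -> : ((t * s')%g k == k) = (t k == k).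
  by rewrite permM -{2}sk (inj_eq perm_inj).
have tE : tperm k (s' (t k)) = (tperm k (t k) ^ s')%g by rewrite tpermJ sk.
by rewrite /remove_symbol permM tE conjgE !mulgA mulgK.
Qed.

Lemma symbol_trace_mulr k (x : galg F l) y :
    k \notin codom f ->
  symbol_trace k (y * galg_emb fI x) = symbol_trace k y * galg_emb fI x.
Proof.
move=> kf; elim/galg_ind: x => [|a x x' IHx IHx'|s].
- by rewrite !(mulr0, linear0).
- by rewrite linearP /= !mulrDr -!scalerAr linearP /= IHx IHx'.
elim/galg_ind: y => [|a y y' IHy IHy'|t]; first by rewrite !(mul0r, linear0).
  by rewrite mulrDl -scalerAl !linearP /= IHy IHy' mulrDl -scalerAl.
rewrite galg_emb_basis galg_basisM !symbol_trace_basis -scalerAl galg_basisM.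
by rewrite /remove_symbol permM (perm_emb_out fI s kf) mulgA.
Qed.

Lemma symbols_trace_mull ks (x : galg F l) y :
    {in ks, forall k, k \notin codom f} ->
  symbols_trace ks (galg_emb fI x * y) = galg_emb fI x * symbols_trace ks y.
Proof.
elim: ks => //= k ks IHks ksf; rewrite IHks => [|i iks].
  by rewrite symbol_trace_mull // ksf ?mem_head.
by rewrite ksf // in_cons iks orbT.
Qed.

End Bimodule.

End SymbolTrace.

(** Deletion of symbols is natural with respect to relabelling. *)
Lemma symbols_trace_emb (F : fieldType) l N (f : 'I_l -> 'I_N)
    (fI : injective f) (p : F) ks x :
  symbols_trace p (map f ks) (galg_emb fI x) =
    galg_emb fI (symbols_trace p ks x).
Proof.
elim: ks => //= k ks ->; move: {x}(symbols_trace _ _ _) => x.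
elim/galg_ind: x => [|a x y IHx IHy|s]; first by rewrite !linear0.
  by rewrite !linearP /= IHx IHy.
rewrite galg_emb_basis !symbol_trace_basis linearZ /= galg_emb_basis.
rewrite perm_embE (inj_eq fI) /remove_symbol perm_embM perm_emb_tperm.
by rewrite perm_embE.
Qed.

(** * The partial trace as an iterated deletion *)

Section DeletedSymbols.
Variables (n m : nat).
Implicit Types (s : 'S_(n + m)) (a : 'I_n) (i : 'I_m).

Lemma keep_low_lshift a : keep_low (lshift m a) = Some a.
Proof. by rewrite /keep_low -/(unsplit (inl _)) unsplitK. Qed.

Lemma keep_low_rshift i : keep_low (rshift n i) = None.
Proof. by rewrite /keep_low -/(unsplit (inr _)) unsplitK. Qed.

Lemma keep_lowK : ocancel (@keep_low n m) (lshift m).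
Proof.
by move=> k; case: (split_ordP k) => [a|i] ->;
  rewrite ?keep_low_lshift ?keep_low_rshift.
Qed.

(** Deleting one high symbol does not change what is left once all of them are
deleted, since a cycle is read with the high symbols skipped. *)
Lemma delete_perm_remove i s :
  delete_perm (remove_symbol (rshift n i) s) = delete_perm s.
Proof.
apply/permP=> a; rewrite !permE /delete_fun; congr (next _ a).
rewrite /low_cycle orbit_remove_symbol ?eq_lrshift //.
elim: (fingraph.orbit _ _) => //= y c IHc.
by have [->|_ /=] := eqVneq y; rewrite /= ?keep_low_rshift IHc.
Qed.

Lemma delete_perm_low s a :
    all (fun k => keep_low k) (fingraph.orbit s (lshift m a)) ->
  lshift m (delete_perm s a) = s (lshift m a).
Proof.
move=> /all_filterP lowE; rewrite permE /delete_fun.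
rewrite -(next_map (@lshift_inj n m)) ?low_cycle_uniq //.
rewrite /low_cycle (pmap_filter keep_lowK) lowE.
have s_cycle := cycle_orbit (@perm_inj _ s) (lshift m a).
by have /eqP := next_cycle s_cycle (in_orbit _ _).
Qed.

Lemma orbit_fixed s k : s k = k -> fingraph.orbit s k =i pred1 k.
Proof.
move=> sk y; rewrite -fconnect_orbit; apply/idP/eqP=> [|->]; last exact: connect0.
by move/iter_findex <-; elim: (findex _ _ _) => //= d ->.
Qed.

(** Once every high symbol is fixed, there is nothing left to delete. *)
Lemma delete_perm_emb s : (forall i, s (rshift n i) = rshift n i) ->
  s = perm_emb (@lshift_inj n m) (delete_perm s).
Proof.
move=> s_high; apply: perm_emb_uniq => [a|k].
  rewrite delete_perm_low //; apply/allP=> k.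
  case: (split_ordP k) => [b|i] ->; first by rewrite keep_low_lshift.
  rewrite -fconnect_orbit fconnect_sym; last exact: perm_inj.
  by rewrite fconnect_orbit orbit_fixed // inE eq_lrshift.
by case: (split_ordP k) => [b|i] -> //; rewrite codom_f.
Qed.

Lemma delete_perm_fixed s :
  (forall a, s (lshift m a) = lshift m a) -> delete_perm s = 1%g.
Proof.
move=> s_low; apply/permP=> a; apply: (@lshift_inj _ m).
rewrite delete_perm_low ?perm1 //; apply/allP=> k.
by rewrite orbit_fixed // inE => /eqP ->; rewrite keep_low_lshift.
Qed.

End DeletedSymbols.

Section PartialTrace.
Variables (F : fieldType) (n m : nat) (p : F).
Implicit Types (s : 'S_(n + m)).

HB.instance Definition _ :=
  GRing.Linear.copy (@ptrace F n m p) (galg_ext _).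
HB.instance Definition _ := GRing.Linear.copy (@theta F n m) (galg_ext _).

Lemma ptrace_basis s :
  ptrace p (galg_basis F s) =
    p ^+ (num_orbits s - num_orbits (delete_perm s)) *:
      galg_basis F (delete_perm s).
Proof. exact: galg_ext_basis. Qed.

Lemma theta_emb : @theta F n m =1 galg_emb (@rshift_inj n m).
Proof.
apply: galg_linear_eq => s /=; rewrite galg_emb_basis [LHS]galg_ext_basis.
congr galg_basis; apply: perm_emb_uniq => [i|k]; rewrite permE /shift_fun.
  by rewrite -/(unsplit (inr _)) unsplitK.
by case: split_ordP => // i -> /negP[]; apply: codom_f.
Qed.

(** Each deletion contributes either one factor p (if the symbol is a fixed point)
or one new orbit, so the exponent e of p is controlled by counting orbits. *)
Lemma symbols_trace_high (hs : seq 'I_m) s :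
  exists (t : 'S_(n + m)) (e : nat),
    [/\ symbols_trace p (map (@rshift n m) hs) (galg_basis F s) =
          p ^+ e *: galg_basis F t,
        delete_perm t = delete_perm s,
        (num_orbits t + e = num_orbits s + size hs)%N &
        {in hs, forall i, t (rshift n i) = rshift n i}].
Proof.
elim: hs => [|i hs [t [e [trE delE numE t_hs]]]] /=.
  by exists s, 0; rewrite expr0 scale1r.
exists (remove_symbol (rshift n i) t), (e + (t (rshift n i) == rshift n i))%N.
split=> [|||j].
- by rewrite trE linearZ /= symbol_trace_basis scalerA exprD.
- by rewrite delete_perm_remove.
- rewrite num_orbits_remove_symbol addnACA numE addnS -[in RHS]addn1.
  by case: eqP; rewrite ?addn0 ?addnA.
rewrite inE => /predU1P[->|/t_hs]; first exact: remove_symbol_self.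
exact: remove_symbol_fixed.
Qed.

(** After all m deletions the permutation t is the embedded tau and has c(tau) + m
orbits; comparing with the orbit count above, the accumulated exponent of p is
c(sigma) - c(tau). *)
Lemma ptraceE (x : galg F (n + m)) :
  galg_emb (@lshift_inj n m) (ptrace p x) =
    symbols_trace p (map (@rshift n m) (enum 'I_m)) x.
Proof.
elim/galg_ind: x => [|a x y IHx IHy|s]; first by rewrite !linear0.
  by rewrite !linearP /= IHx IHy.
have [t [e [-> delE]]] := symbols_trace_high (enum 'I_m) s.
rewrite size_enum_ord => numE t_high.
have tE := delete_perm_emb (fun i => t_high i (mem_enum _ i)).
have numt : (num_orbits t = num_orbits (delete_perm t) + m)%N.
  by apply: (@addIn n); rewrite {1}tE num_orbits_emb -addnA (addnC n).
rewrite ptrace_basis linearZ /= galg_emb_basis -delE -tE; congr (p ^+ _ *: _).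
move: numE; rewrite numt addnAC => /addIn <-; exact: addKn.
Qed.


(** A permutation of the high symbols alone becomes the identity after deletion;
this makes the leading coefficient of T_m a scalar. *)
Lemma ptrace_theta (x : galg F m) : exists c, ptrace p (theta n x) = c%:A.
Proof.
elim/galg_ind: x => [|a x y [c IHx] [d IHy]|s].
- by exists 0; rewrite !linear0 scale0r.
- by exists (a * c + d); rewrite !linearP /= IHx IHy scalerDl scalerA.
rewrite theta_emb galg_emb_basis ptrace_basis delete_perm_fixed => [|a].
  by eexists.
by apply: perm_emb_out; apply/codomP=> -[i /eqP]; rewrite eq_lrshift.
Qed.

End PartialTrace.

(** * Multiplicativity and cyclicity of the partial trace *)

Section HighMap.
Variables (n m m' : nat) (g : 'I_m -> 'I_m').

Definition high_map (k : 'I_(n + m)) : 'I_(n + m') :=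
  match split k with inl a => lshift m' a | inr i => rshift n (g i) end.

Lemma high_map_lshift a : high_map (lshift m a) = lshift m' a.
Proof. by rewrite /high_map -/(unsplit (inl _)) unsplitK. Qed.

Lemma high_map_rshift i : high_map (rshift n i) = rshift n (g i).
Proof. by rewrite /high_map -/(unsplit (inr _)) unsplitK. Qed.

Lemma high_map_inj : injective g -> injective high_map.
Proof.
move=> gI k l; case: (split_ordP k) => [a|i] ->; case: (split_ordP l) => [b|j] ->;
  rewrite ?high_map_lshift ?high_map_rshift => /eqP; rewrite eq_shift //.
- by move/eqP->.
- by move/eqP/gI->.
Qed.

End HighMap.

Lemma ord1_const_inj m : injective (fun _ : 'I_1 => ord0 : 'I_m.+1).
Proof. by move=> i j _; rewrite !ord1. Qed.

Section Multiplicativity.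
Variables (F : fieldType) (n m : nat) (p : F).

(** The two groups of auxiliary symbols {0} and {1, ..., m} inside {0, ..., m};
elements of the images share only the low symbols. *)
Definition first_emb := galg_emb (F := F)
  (@high_map_inj n _ _ _ (@ord1_const_inj m)).
Definition rest_emb := galg_emb (F := F)
  (@high_map_inj n _ _ _ (@lift_inj m.+1 ord0)).

HB.instance Definition _ := GRing.LRMorphism.on first_emb.
HB.instance Definition _ := GRing.LRMorphism.on rest_emb.

(** Trace over the symbols 1, ..., m first: the factor [first_emb x] fixes them
and may be pulled out.  What remains of [rest_emb y] fixes the symbol 0 and may be
pulled out of the trace over 0. *)
Lemma ptraceM (x : galg F (n + 1)) (y : galg F (n + m)) :
  ptrace p (first_emb x * rest_emb y) = ptrace p x * ptrace p y.
Proof.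
apply: (galg_emb_inj (fI := @lshift_inj n m.+1)); rewrite rmorphM /= ptraceE.
rewrite enum_ordSl /= -map_comp.
have -> : map (@rshift n m.+1 \o lift ord0) (enum 'I_m) =
    map (high_map (lift ord0)) (map (@rshift n m) (enum 'I_m)).
  by rewrite -[RHS]map_comp; apply: eq_map => i /=; rewrite high_map_rshift.
rewrite symbols_trace_mull => [|k /mapP[_ /mapP[i _ ->] ->]]; last first.
  rewrite high_map_rshift; apply/codomP=> -[j].
  case: (split_ordP j) => [a|i'] ->; rewrite ?high_map_lshift ?high_map_rshift.
    by move/eqP; rewrite eq_shift.
  by move/rshift_inj => /= /eqP; rewrite eq_sym (negPf (neq_lift _ _)).
rewrite symbols_trace_emb -ptraceE.
rewrite (galg_emb_comp _ _ (@lshift_inj n m.+1)) => [|a]; last first.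
  by rewrite /= high_map_lshift.
rewrite symbol_trace_mulr; last first.
  by apply/codomP=> -[a /eqP]; rewrite eq_shift.
congr (_ * _); transitivity (first_emb (galg_emb (@lshift_inj n 1) (ptrace p x))).
  rewrite ptraceE /first_emb -symbols_trace_emb -map_comp enum_ordSl enum_ord0 /=.
  by rewrite high_map_rshift.
by apply: galg_emb_comp => a; rewrite /= high_map_lshift.
Qed.

End Multiplicativity.

Section Cyclicity.
Variables (F : fieldType) (n m : nat) (p : F).
Implicit Types s h : 'S_(n + m).

Lemma orbit_conjg s h k :
  fingraph.orbit (s ^ h)%g (h k) = map h (fingraph.orbit s k).
Proof.
have := cycle_orbit (@perm_inj _ s) k; have := orbit_uniq s k.
rewrite /fingraph.orbit -orderSpred /=; set c := traject _ _ _ => Uc sC.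
rewrite -[RHS]undup_id; last first.
  by rewrite -/(map h (k :: c)) map_inj_uniq //; apply: perm_inj.
rewrite (@undup_cycle_cons _ (s ^ h)%g) //.
rewrite -/(map h (k :: c)) cycle_map.
rewrite (eq_cycle (e' := frel s)) // => x y.
by rewrite /= permJ (inj_eq perm_inj).
Qed.

(** Conjugation by a permutation of the high symbols only renames symbols that are
deleted anyway. *)
Lemma delete_perm_conjg s (h : 'S_m) :
  delete_perm (s ^ shift_perm n h)%g = delete_perm s.
Proof.
set h' := shift_perm n h.
have h'_low a : h' (lshift m a) = lshift m a.
  by rewrite permE /shift_fun -/(unsplit (inl _)) unsplitK.
have h'_keep k : keep_low (h' k) = keep_low k.
  case: (split_ordP k) => [a|i] ->; rewrite ?h'_low // permE /shift_fun.
  by rewrite -/(unsplit (inr _)) unsplitK !keep_low_rshift.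
apply/permP=> a; rewrite !permE /delete_fun; congr (next _ a).
rewrite /low_cycle -{1}h'_low orbit_conjg.
by elim: (fingraph.orbit _ _) => //= k c ->; rewrite h'_keep.
Qed.

(** Conjugation is the embedding along a bijection. *)
Lemma num_orbits_conjg s h : num_orbits (s ^ h)%g = num_orbits s.
Proof.
have -> : (s ^ h)%g = perm_emb (@perm_inj _ h) s.
  apply: perm_emb_uniq => [k|k /negP[]]; first by rewrite permJ.
  by rewrite -[k](permKV h) codom_f.
exact: (addIn (num_orbits_emb _ _)).
Qed.

(** For permutations the products in the two orders are conjugate by h'. *)
Lemma ptrace_thetaC (x : galg F m) (y : galg F (n + m)) :
  ptrace p (theta n x * y) = ptrace p (y * theta n x).
Proof.
elim/galg_ind: x => [|a x x' IHx IHx'|h]; first by rewrite linear0 mul0r mulr0.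
  by rewrite linearP /= mulrDl mulrDr -scalerAl -scalerAr !linearP /= IHx IHx'.
rewrite [theta _ _]galg_ext_basis.
elim/galg_ind: y => [|a y y' IHy IHy'|s]; first by rewrite mulr0 mul0r.
  by rewrite mulrDl mulrDr -scalerAl -scalerAr !linearP /= IHy IHy'.
set h' := shift_perm n h; rewrite !galg_basisM !ptrace_basis.
have -> : (s * h' = (h' * s) ^ h')%g by rewrite conjgE -mulgA mulKg.
by rewrite num_orbits_conjg delete_perm_conjg.
Qed.

End Cyclicity.

(** * Antisymmetrizers *)

Lemma antisymmetrizer1 (F : fieldType) : antisymmetrizer F 1 = 1.
Proof.
rewrite /antisymmetrizer (bigD1 1%g) //= big1 => [|s s1].
  by rewrite odd_perm1 invr1 addr0 !scale1r.
by case/eqP: s1; apply/permP=> i; rewrite !ord1.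
Qed.

Section Antisymmetrizer.
Variable F : fieldType.
Hypothesis F_char0 : [pchar F] =i pred0.

Let factF_neq0 m : (m`!)%:R != 0 :> F.
Proof. by rewrite (pcharf0P F).1 // -lt0n fact_gt0. Qed.

Section FixedSize.
Variable m : nat.
Notation asym := (antisymmetrizer F m).

Lemma antisymmetrizer_left (s : 'S_m) :
  galg_basis F s * asym = (-1) ^+ s *: asym.
Proof.
rewrite /antisymmetrizer -scalerAr scalerA mulrC -scalerA; congr (_ *: _).
rewrite mulr_sumr scaler_sumr [RHS](reindex_inj (mulIg s)) /=.
apply: eq_bigr => t _; rewrite -scalerAr galg_basisM scalerA odd_permM signr_addb.
by rewrite mulrCA -expr2 sqrr_sign mulr1.
Qed.

Lemma antisymmetrizer_right (s : 'S_m) :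
  asym * galg_basis F s = (-1) ^+ s *: asym.
Proof.
rewrite /antisymmetrizer -scalerAl scalerA mulrC -scalerA; congr (_ *: _).
rewrite mulr_suml scaler_sumr [RHS](reindex_inj (mulgI s)) /=.
apply: eq_bigr => t _; rewrite -scalerAl galg_basisM scalerA odd_permM signr_addb.
by rewrite mulrA -expr2 sqrr_sign mul1r.
Qed.

(** The antisymmetrizer is the projection onto the sign-isotypic part. *)
Lemma antisymmetrizer_absorb (x : galg F m) :
  (forall s, galg_basis F s * x = (-1) ^+ s *: x) -> asym * x = x.
Proof.
move=> sx; rewrite /antisymmetrizer -scalerAl mulr_suml.
under eq_bigr => s _ do rewrite -scalerAl sx scalerA -expr2 sqrr_sign scale1r.
by rewrite sumr_const card_Sn -scaler_nat scalerA mulVf ?scale1r.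
Qed.

Lemma antisymmetrizer_idem : asym * asym = asym.
Proof. exact/antisymmetrizer_absorb/antisymmetrizer_left. Qed.

End FixedSize.

Section Induction.
Variable m : nat.
Notation asymS := (antisymmetrizer F m.+1).
Notation emb := (galg_emb (F := F) (@lift_inj m.+1 ord0)).
Notation asym := (emb (antisymmetrizer F m)).

Lemma antisymmetrizerS_left : asym * asymS = asymS.
Proof.
rewrite {1}/antisymmetrizer linearZ /= -scalerAl linear_sum /= mulr_suml.
under eq_bigr => s _.
  rewrite linearZ /= galg_emb_basis -scalerAl antisymmetrizer_left odd_perm_emb.
  rewrite scalerA -expr2 sqrr_sign scale1r.
  over.
by rewrite sumr_const card_Sn -scaler_nat scalerA mulVf ?scale1r.
Qed.

Lemma antisymmetrizerS_right : asymS * asym = asymS.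
Proof.
rewrite {2}/antisymmetrizer linearZ /= -scalerAr linear_sum /= mulr_sumr.
under eq_bigr => s _.
  rewrite linearZ /= galg_emb_basis -scalerAr antisymmetrizer_right odd_perm_emb.
  rewrite scalerA -expr2 sqrr_sign scale1r.
  over.
by rewrite sumr_const card_Sn -scaler_nat scalerA mulVf ?scale1r.
Qed.

(** Permutations act on the right-hand side through the sign: this is seen for the
transpositions moving 0, which generate.  The larger antisymmetrizer therefore
absorbs the right-hand side; it also absorbs each of the m + 1 signed
terms of the first factor and the smaller antisymmetrizer, which leaves m + 1
times itself. *)
Lemma antisymmetrizerS :
  m.+1%:R *: asymS = (1 - \sum_(i < m) transp F ord0 (lift ord0 i)) * asym.
Proof.
set x := RHS.
have transp_asymS i : asymS * transp F ord0 (lift ord0 i) = - asymS.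
  by rewrite antisymmetrizer_right odd_tperm neq_lift scaleN1r.
have transp_x j : transp F ord0 (lift ord0 j) * x = - x.
  pose y := \sum_(i < m | i != j) transp F ord0 (lift ord0 i) * asym.
  have xE : x = asym - transp F ord0 (lift ord0 j) * asym - y.
    by rewrite /x /y (bigD1 j) //= mulrBl mul1r mulrDl mulr_suml opprD addrA.
  suff yE : transp F ord0 (lift ord0 j) * y = - y.
    rewrite xE !mulrBr mulrA transpM2 mul1r yE opprK !opprB.
    exact: addrC.
  rewrite mulr_sumr.
  rewrite -sumrN; apply: eq_bigr => i ij.
  rewrite mulrA [transp F _ (lift ord0 i)]transpC -transpM_left; last 2 first.
  - by rewrite (inj_eq lift_inj) eq_sym.
  - by rewrite eq_sym neq_lift.
  rewrite -mulrA -(galg_emb_transp F (@lift_inj _ ord0)) -rmorphM /=.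
  rewrite antisymmetrizer_left odd_tperm ij.
  by rewrite scaleN1r rmorphN mulrN transpC.
have basis_x s : galg_basis F s * x = (-1) ^+ s *: x.
  pose G := [set s : 'S_m.+1 | galg_basis F s * x == (-1) ^+ s *: x].
  have G_group : group_set G.
    apply/group_setP; split=> [|t u].
      by rewrite inE galg_basis1 mul1r odd_perm1 scale1r.
    rewrite !inE => /eqP tx /eqP ux; rewrite -galg_basisM -mulrA tx -scalerAr ux.
    by rewrite scalerA odd_permM signr_addb.
  suff : s \in group G_group by rewrite inE => /eqP.
  apply: subsetP (in_setT s); rewrite -(gen_tperm ord0) gen_subG.
  apply/subsetP=> _ /imsetP[j _ ->]; rewrite inE odd_tperm.
  case: (unliftP ord0 j) => [i ->|->].
    by rewrite transp_x neq_lift scaleN1r.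
  by rewrite tperm1 galg_basis1 mul1r eqxx scale1r.
rewrite -[RHS](antisymmetrizer_absorb basis_x) /x mulrA.
rewrite [asymS * _](_ : _ = asymS *+ m.+1).
  by rewrite mulrnAl antisymmetrizerS_right scaler_nat.
rewrite mulrBr mulr1 mulr_sumr.
under eq_bigr => i _ do rewrite transp_asymS.
by rewrite sumr_const card_ord mulNrn opprK -mulrS.
Qed.

End Induction.
End Antisymmetrizer.

(** * Fusion in an abstract ring *)

(** The hypotheses are those satisfied by the elements A, B, P and S described at
the beginning, for sites ranging over I.  The relation PSA says that
(P S - P) A lies in the right ideal of B, which is why it is annihilated by
A - B. *)
Section Fusion.
Variables (R : nzRingType) (I : eqType) (A B : R) (P Q S : I -> R).

Hypothesis AA : A * A = A.
Hypothesis AB : A * B = B.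
Hypothesis BA : B * A = B.
Hypothesis BB : B * B = B.
Hypothesis A_P : forall a, GRing.comm A (P a).
Hypothesis A_S : forall a, GRing.comm A (S a).
Hypothesis B_PS : forall a, GRing.comm B (P a + S a).
Hypothesis PSB : forall a, P a * S a * B = - (S a * B).
Hypothesis PSA : forall a, (P a * S a - P a) * A = B * Q a.
Hypothesis P_S : forall a b, a != b -> GRing.comm (S a) (P b).

Local Notation L0 a := ('X + (P a)%:P : {poly R}).
Local Notation Lm a := ('X - 1 + (S a)%:P : {poly R}).
Local Notation L a := ('X + (P a + S a)%:P : {poly R}).
Local Notation W a := ('X - 1 + (P a + S a)%:P : {poly R}).

Lemma comm_XaddC (x y : R) : GRing.comm x y -> GRing.comm x%:P ('X + y%:P).
Proof.
move=> xy; rewrite /GRing.comm mulrDr mulrDl commr_polyX -!polyCM.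
by rewrite (xy : x * y = y * x).
Qed.

Lemma comm_XsubaddC (x y : R) :
  GRing.comm x y -> GRing.comm x%:P ('X - 1 + y%:P).
Proof.
move=> xy; rewrite -addrA -[1]polyC1 -polyCN -polyCD; apply: comm_XaddC.
by apply: commrD => //; apply: commrN1.
Qed.

(** The part of the factor that survives at u = 0 is separated from the rest. *)
Lemma product_of_factors a : L0 a * Lm a = 'X * W a + (P a * S a - P a)%:P.
Proof.
rewrite mulrDl !mulrDr [(P a)%:P * 'X]commr_polyX !mulrN !mulr1.
rewrite polyCB polyCD polyCM mulrDr.
by rewrite [LHS](AC (3 * 3) (1 * 2 * (4 * 3) * (6 * 5)))%AC.
Qed.

(** On the image of B the relation P S = - S turns the constant term P S - P into
-(P + S), and the factor u - 1 splits off. *)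
Lemma factors_times_B a : L0 a * Lm a * B%:P = ('X - 1) * L a * B%:P.
Proof.
have -> : ('X - 1) * L a = 'X * W a - (P a + S a)%:P.
  rewrite mulrBl mul1r !mulrDr mulrN mulr1 opprD.
  by rewrite [LHS](AC (2 * 2) (1 * 3 * 2 * 4))%AC.
rewrite product_of_factors !mulrDl; congr (_ + _).
rewrite mulNr -!polyCM -polyCN mulrBl PSB mulrDl opprD; congr _%:P.
exact: addrC.
Qed.

Lemma comm_A_W a : GRing.comm A%:P (W a).
Proof. by apply/comm_XsubaddC/commrD. Qed.

(** The constant term P S - P is killed by A - B, which leaves a multiple of u.
The trailing A - B is kept so that the next factor can be treated in the same
way. *)
Lemma complement_times_factors a :
  (A - B)%:P * (L0 a * Lm a) = 'X * ((A - B)%:P * W a * (A - B)%:P).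
Proof.
have CA : (A - B) * A = A - B by rewrite mulrBl AA BA.
have CB : (A - B) * B = 0 by rewrite mulrBl AB BB subrr.
have CW : (A - B)%:P * W a = (A - B)%:P * W a * (A - B)%:P.
  rewrite polyCB mulrBr -polyCB.
  have -> : (A - B)%:P * W a * B%:P = 0.
    rewrite -mulrA -(comm_XsubaddC (B_PS a)) mulrA -polyCM CB.
    by rewrite mul0r.
  by rewrite subr0 -[RHS]mulrA -comm_A_W mulrA -polyCM CA.
have A_X : GRing.comm A%:P (L0 a * Lm a).
  by apply: commrM; [apply: comm_XaddC | apply: comm_XsubaddC].
rewrite -{1}CA polyCM -mulrA A_X product_of_factors mulrDl mulrDr.
rewrite -polyCM PSA -polyCM [_ * (B * _)]mulrA CB mul0r addr0.
rewrite -CW -!mulrA -comm_A_W mulrA commr_polyX -mulrA; congr ('X * _).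
by rewrite mulrA -polyCM CA.
Qed.

Lemma complement_times_prod (l : seq I) : exists V,
  (A - B)%:P * \prod_(a <- l) (L0 a * Lm a) = 'X^(size l) * V.
Proof.
elim: l => [|a l [V IH]]; first by exists (A - B)%:P; rewrite big_nil mulr1 mul1r.
exists ((A - B)%:P * W a * V); rewrite big_cons mulrA complement_times_factors.
rewrite -!mulrA IH exprS -!mulrA; congr ('X * _).
by rewrite !mulrA; congr (_ * V); rewrite commr_polyXn -mulrA.
Qed.

Lemma prod_times_B (l : seq I) :
  (\prod_(a <- l) (L0 a * Lm a)) * B%:P =
    ('X - 1) ^+ (size l) * (B%:P * \prod_(a <- l) L a).
Proof.
have B_L a : GRing.comm B%:P (L a) by apply: comm_XaddC.
elim: l => [|a l IH]; first by rewrite !big_nil mulr1 !mul1r.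
have shift_central x k : GRing.comm x (('X - 1 : {poly R}) ^+ k).
  by apply/commrX/commrB; [apply: commr_polyX | apply: commr1].
rewrite !big_cons -mulrA IH mulrA shift_central -!mulrA exprSr -mulrA.
congr (_ * _); rewrite 2!mulrA factors_times_B -!mulrA; congr (_ * _).
by rewrite mulrA -B_L mulrA.
Qed.

(** Factors at different sites commute, so the two families can be collected. *)
Lemma prod_factors (l : seq I) : uniq l ->
  \prod_(a <- l) (L0 a * Lm a) = \prod_(a <- l) L0 a * \prod_(a <- l) Lm a.
Proof.
elim: l => [|a l IH] /=; first by rewrite !big_nil mulr1.
move=> /andP[al /IH lE]; rewrite !big_cons lE -!mulrA; congr (_ * _).
rewrite !mulrA; congr (_ * _); rewrite big_seq.
apply: commr_prod => b bl; apply: commrD; first exact: commr_polyX.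
apply/commr_sym/comm_XsubaddC/commr_sym/P_S.
by apply: contraNneq al => ->.
Qed.

Lemma comm_A_prod (l : seq I) : GRing.comm A%:P (\prod_(a <- l) L0 a).
Proof. by apply: commr_prod => a _; apply: comm_XaddC. Qed.

End Fusion.

(** * Linear maps, shifts and products of polynomials *)

Lemma map_rev_ord_enum n : map (@rev_ord n) (enum 'I_n) = rev (enum 'I_n).
Proof.
apply: (inj_map val_inj); rewrite map_rev val_enum_ord -map_comp.
rewrite (eq_map (g := (fun i => n - i.+1)%N \o val)) // map_comp val_enum_ord.
apply: (@eq_from_nth _ 0%N) => [|i]; first by rewrite size_rev size_map.
rewrite size_map size_iota => lt_in.
rewrite (nth_map 0%N) ?size_iota // nth_rev ?size_iota // !nth_iota //.
by rewrite ltn_subrL (leq_ltn_trans _ lt_in).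
Qed.

Lemma prod_rev_ord (R : nzRingType) n (f : 'I_n -> R) :
  \prod_(a < n) f (rev_ord a) = \prod_(a <- rev (enum 'I_n)) f a.
Proof. by rewrite -map_rev_ord_enum big_map [index_enum _]unlock -enumT. Qed.

Section PolyTools.
Variables (R R' : nzRingType) (f : {additive R -> R'}).

(** Substitution is multiplicative over a noncommutative ring because u - 1 is
central. *)
Lemma comp_poly_shiftM (x y : {poly R}) :
  (x * y) \Po ('X - 1) = (x \Po ('X - 1)) * (y \Po ('X - 1)).
Proof.
rewrite /comp_poly rmorphM hornerM_comm //.
apply: commr_sym.
by apply: commrB; [apply: commr_polyX | apply: commr1].
Qed.

Lemma map_polyMX (x : {poly R}) : map_poly f (x * 'X) = map_poly f x * 'X.
Proof.
by apply/polyP=> i; rewrite coef_map !coefMX coef_map; case: eqP; rewrite ?raddf0.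
Qed.

Lemma map_poly_shift (x : {poly R}) :
  map_poly f (x \Po ('X - 1)) = map_poly f x \Po ('X - 1).
Proof.
elim/poly_ind: x => [|x c IHx]; first by rewrite comp_poly0 raddf0 comp_poly0.
rewrite comp_poly_MXaddC [LHS]raddfD /= map_polyC /=.
have -> : map_poly f (x * 'X + c%:P) = map_poly f x * 'X + (f c)%:P.
  by rewrite raddfD /= map_polyMX map_polyC.
by rewrite comp_poly_MXaddC -IHx !mulrBr !mulr1 raddfB /= map_polyMX.
Qed.

Lemma map_poly_shiftX_exp k (x : {poly R}) :
  map_poly f (('X - 1) ^+ k * x) = ('X - 1) ^+ k * map_poly f x.
Proof.
elim: k x => [|k IHk] x; first by rewrite !mul1r.
rewrite !exprSr -!mulrA IHk; congr (_ * _).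
by rewrite !mulrBl !mul1r -![in LHS]commr_polyX raddfB /= map_polyMX commr_polyX.
Qed.

Lemma map_polyXn_mul k (x : {poly R}) :
  map_poly f ('X^k * x) = 'X^k * map_poly f x.
Proof.
apply/polyP=> i; rewrite coef_map !coefXnM coef_map.
by case: ltnP; rewrite ?raddf0.
Qed.

End PolyTools.

(** A coefficientwise consequence of multiplicativity of h on the images of e1
and e2, which is the form in which [ptraceM] is applied. *)
Lemma map_poly_mul2 (R1 R2 R R' : nzRingType) (e1 : {additive R1 -> R})
    (e2 : {additive R2 -> R}) (h : {additive R -> R'}) (f1 : {additive R1 -> R'})
    (f2 : {additive R2 -> R'}) :
    (forall x y, h (e1 x * e2 y) = f1 x * f2 y) -> forall x y,
  map_poly h (map_poly e1 x * map_poly e2 y) = map_poly f1 x * map_poly f2 y.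
Proof.
move=> hM x y; apply/polyP=> i; rewrite coef_map !coefM raddf_sum /=.
by apply: eq_bigr => j _; rewrite !coef_map /= hM.
Qed.

Section EmbeddedCommutation.
Variables (F : fieldType) (k N : nat) (f : 'I_k -> 'I_N).
Hypothesis fI : injective f.

Lemma comm_emb_transp (u : galg F k) a b : a \notin codom f -> b \notin codom f ->
  GRing.comm (galg_emb fI u) (transp F a b).
Proof.
move=> af bf; elim/galg_ind: u => [|c x y IHx IHy|s].
- by rewrite linear0; apply/commr_sym/commr0.
- rewrite linearP /=; apply/commr_sym/commrD; last exact/commr_sym.
  by rewrite /GRing.comm -scalerAr -scalerAl; congr (_ *: _); apply/esym.
by rewrite galg_emb_basis /GRing.comm galg_basis_transp !perm_emb_out.
Qed.

(** Conjugation by a permutation of the image of f permutes the summands. *)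
Lemma comm_emb_sum_transp (u : galg F k) a : a \notin codom f ->
  GRing.comm (galg_emb fI u) (\sum_i transp F a (f i)).
Proof.
move=> af; elim/galg_ind: u => [|c x y IHx IHy|s].
- by rewrite linear0; apply/commr_sym/commr0.
- rewrite linearP /=; apply/commr_sym/commrD; last exact/commr_sym.
  by rewrite /GRing.comm -scalerAr -scalerAl; congr (_ *: _); apply/esym.
rewrite galg_emb_basis /GRing.comm mulr_sumr mulr_suml.
rewrite [RHS](reindex_inj (@perm_inj _ s)) /=; apply: eq_bigr => i _.
by rewrite galg_basis_transp perm_emb_out // perm_embE.
Qed.

End EmbeddedCommutation.

(** * The fusion relation between T_1, T_m and T_(m+1) *)

Section FusionRelation.
Variables (F : fieldType) (n m : nat) (p : F).
Hypothesis F_char0 : [pchar F] =i pred0.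

Notation N := (n + m.+1)%N.
Let P (a : 'I_n) : galg F N := transp F (lshift m.+1 a) (rshift n ord0).
Let S (a : 'I_n) : galg F N :=
  \sum_(i < m) transp F (lshift m.+1 a) (rshift n (lift ord0 i)).
Let A : galg F N := rest_emb (theta n (antisymmetrizer F m)).
Let B : galg F N := theta n (antisymmetrizer F m.+1).

Let Q (a : 'I_n) : galg F N := - m.+1%:R *: P a.

Let rest_inj : injective (@rshift n m.+1 \o lift ord0).
Proof. exact/inj_comp/lift_inj/rshift_inj. Qed.

Let A_rest : A = galg_emb rest_inj (antisymmetrizer F m).
Proof.
by rewrite /A theta_emb; apply: galg_emb_comp => i; rewrite /= high_map_rshift.
Qed.

Let A_emb : A = galg_emb (@rshift_inj n m.+1)
   (galg_emb (@lift_inj _ ord0) (antisymmetrizer F m)).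
Proof. by rewrite A_rest; apply/esym/galg_emb_comp. Qed.

Let B_emb : B = galg_emb (@rshift_inj n m.+1) (antisymmetrizer F m.+1).
Proof. exact: theta_emb. Qed.

Let lshift_out l (g : 'I_l -> 'I_m.+1) a :
  lshift m.+1 a \notin codom (@rshift n m.+1 \o g).
Proof. by apply/codomP=> -[i /eqP]; rewrite /= eq_lrshift. Qed.

Let A_P a : GRing.comm A (P a).
Proof.
rewrite A_rest; apply: comm_emb_transp; first exact: lshift_out.
by apply/codomP=> -[i /rshift_inj/eqP]; rewrite (negPf (neq_lift _ _)).
Qed.

Let A_S a : GRing.comm A (S a).
Proof. by rewrite A_rest; apply: comm_emb_sum_transp; apply: lshift_out. Qed.

Let sumE a : P a + S a = \sum_(i < m.+1) transp F (lshift m.+1 a) (rshift n i).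
Proof. by rewrite big_ord_recl. Qed.

Let B_PS a : GRing.comm B (P a + S a).
Proof.
by rewrite sumE B_emb; apply: comm_emb_sum_transp; apply: (lshift_out id).
Qed.

Let transp_high (i : 'I_m) : transp F (rshift n ord0) (rshift n (lift ord0 i)) =
  galg_emb (@rshift_inj n m.+1) (transp F ord0 (lift ord0 i)).
Proof. by rewrite galg_emb_transp. Qed.

(** The product of P and a term of S is that term times a transposition of two
auxiliary symbols, which B turns into -1. *)
Let PSB a : P a * S a * B = - (S a * B).
Proof.
rewrite [P a * S a]mulr_sumr [LHS]mulr_suml [S a * B]mulr_suml -sumrN.
apply: eq_bigr => i _.
rewrite /P [transp F _ (rshift _ (lift _ _))]transpC -transpM_left; last 2 first.
- by rewrite eq_rshift neq_lift.
- by rewrite eq_rlshift.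
rewrite -mulrA [transp F (rshift _ _) (rshift _ _)]transpC.
rewrite transp_high B_emb -rmorphM /= antisymmetrizer_left odd_tperm.
by rewrite neq_lift scaleN1r rmorphN mulrN transpC.
Qed.

(** Moving P to the right of S turns P S - P into -(1 - t) P, where t is the sum
of the transpositions of 0 and i; and (1 - t) A = (m + 1) B. *)
Let PSA a : (P a * S a - P a) * A = B * Q a.
Proof.
have -> : P a * S a - P a =
    - (galg_emb (@rshift_inj n m.+1)
         (1 - \sum_(i < m) transp F ord0 (lift ord0 i)) * P a).
  rewrite rmorphB rmorph1 /= mulrBl mul1r opprB; congr (_ - _).
  rewrite [LHS]mulr_sumr raddf_sum /= [RHS]mulr_suml; apply: eq_bigr => i _.
  rewrite -transp_high /P -transpM_left //.
  - by rewrite eq_rlshift.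
  - by rewrite eq_rshift eq_sym neq_lift.
rewrite mulNr -mulrA -A_P mulrA A_emb -rmorphM /= -antisymmetrizerS //.
by rewrite linearZ /= -B_emb -scalerAl /Q -scalerAr scaleNr.
Qed.

Let P_S a b : a != b -> GRing.comm (S a) (P b).
Proof.
move=> ab; apply/commr_sym/commr_sum => i _; apply: transpM_disjoint.
- by rewrite eq_lshift.
- by rewrite eq_lrshift.
- by rewrite eq_rlshift.
- by rewrite eq_rshift eq_sym neq_lift.
Qed.

Let AA : A * A = A.
Proof. by rewrite A_rest -rmorphM antisymmetrizer_idem. Qed.

Let AB : A * B = B.
Proof. by rewrite A_emb B_emb -rmorphM /= antisymmetrizerS_left. Qed.

Let BA : B * A = B.
Proof. by rewrite A_emb B_emb -rmorphM /= antisymmetrizerS_right. Qed.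

Let BB : B * B = B.
Proof. by rewrite B_emb -rmorphM antisymmetrizer_idem. Qed.

Lemma Tpoly_fusion : exists V,
  Tpoly n 1 p * (Tpoly n m p \Po ('X - 1)) =
    ('X - 1) ^+ n * Tpoly n m.+1 p + 'X^n * V.
Proof.
pose l := rev (enum 'I_n).
have Ul : uniq l by rewrite rev_uniq enum_uniq.
have size_l : size l = n by rewrite size_rev size_enum_ord.
have TpolyE k : Tpoly n k p = map_poly (ptrace p)
    ((theta n (antisymmetrizer F k))%:P * \prod_(a <- l) Tfactor F k a).
  by rewrite /Tpoly prod_rev_ord.
have thetaP1 : theta n (antisymmetrizer F 1) = 1.
  by rewrite antisymmetrizer1 theta_emb rmorph1.
have first_factors : map_poly (first_emb m) (\prod_(a <- l) Tfactor F 1 a) =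
    \prod_(a <- l) ('X + (P a)%:P).
  rewrite rmorph_prod; apply: eq_bigr => a _ /=.
  rewrite rmorphD /= map_polyX map_polyC /= big_ord1 /first_emb galg_emb_transp.
  by rewrite high_map_lshift high_map_rshift.
have rest_factors : map_poly (@rest_emb F n m)
    (((theta n (antisymmetrizer F m))%:P * \prod_(a <- l) Tfactor F m a)
       \Po ('X - 1)) =
    A%:P * \prod_(a <- l) ('X - 1 + (S a)%:P).
  rewrite map_poly_shift rmorphM /= map_polyC /= comp_poly_shiftM comp_polyC.
  congr (_ * _); rewrite rmorph_prod.
  rewrite (big_morph (comp_poly ('X - 1)) (@comp_poly_shiftM _) (comp_polyC 1 _)).
  apply: eq_bigr => a _; rewrite rmorphD /= map_polyX map_polyC /= comp_polyD.
  rewrite comp_polyX comp_polyC linear_sum; congr (_ + _%:P).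
  apply: eq_bigr => i _.
  by rewrite /= /rest_emb galg_emb_transp high_map_lshift high_map_rshift.
have tr_prod : Tpoly n 1 p * (Tpoly n m p \Po ('X - 1)) =
    map_poly (ptrace p)
      (A%:P * \prod_(a <- l) (('X + (P a)%:P) * ('X - 1 + (S a)%:P))).
  rewrite !TpolyE thetaP1 polyC1 mul1r -map_poly_shift.
  rewrite -(map_poly_mul2 (@ptraceM F n m p)) first_factors rest_factors.
  rewrite (prod_factors P_S Ul) !mulrA; congr (map_poly _ (_ * _)).
  by rewrite (comm_A_prod A_P).
have [V V_E] := @complement_times_prod (galg F N) _ A B P Q S
  AA AB BA BB A_P A_S B_PS PSA l.
exists (map_poly (ptrace p) V); rewrite tr_prod -(subrK B A).
rewrite polyCD mulrDl V_E addrC raddfD /= map_polyXn_mul size_l; congr (_ + _).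
rewrite TpolyE -/B -map_poly_shiftX_exp -{1}BB polyCM -mulrA.
(* Cyclicity moves one copy of B to the right end, where it simplifies the
   factors one after another. *)
transitivity (map_poly (ptrace p)
  (B%:P * \prod_(a <- l) (('X + (P a)%:P) * ('X - 1 + (S a)%:P)) * B%:P)).
  apply/polyP=> i; rewrite !coef_map /= coefCM coefMC.
  by rewrite ptrace_thetaC.
rewrite -mulrA (prod_times_B B_PS PSB).
congr (map_poly _ _); rewrite size_l.
have B_shift : B%:P * ('X - 1) ^+ n = ('X - 1) ^+ n * B%:P.
  by apply/commrX/commrB; [apply: commr_polyX | apply: commr1].
rewrite [LHS]mulrA B_shift -mulrA; congr (_ * _); rewrite mulrA -polyCM BB.
by congr (_ * _); apply: eq_bigr => a _; rewrite sumE.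
Qed.

End FusionRelation.

(** * The coefficients of T_1 *)

Section FirstTransferMatrix.
Variables (F : fieldType) (n : nat) (p : F).

Local Notation low := (galg_emb (F := F) (@lshift_inj n 1)).
Local Notation P a := (transp F (lshift 1 a) (rshift n ord0)).

Lemma chain_cons2 (a b : 'I_n) t :
  chain F (a :: b :: t) = transp F a b * chain F (b :: t).
Proof. by rewrite /chain /= big_cons. Qed.

Lemma chain1 (a : 'I_n) : chain F [:: a] = 1.
Proof. by rewrite /chain /= big_nil. Qed.

(** The auxiliary symbol is carried through the product: in the list a, b, t the
product of the transpositions of (b, 0) and (a, 0) equals the transposition of
(a, b) times that of (b, 0), and the former commutes with everything coming
from t.  At the end a single transposition moving the auxiliary symbol is left,
to be deleted by the trace. *)
Lemma prod_transp_chain a (t : seq 'I_n) : uniq (a :: t) ->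
  \prod_(b <- rev (a :: t)) P b = low (chain F (a :: t)) * P (last a t).
Proof.
elim: t a => [|b t IH] a /=; first by rewrite big_seq1 chain1 rmorph1 mul1r.
case/andP=> a_t /[dup] /andP[b_t _] Ut.
have -> : rev (a :: b :: t) = rev t ++ [:: b; a].
  by rewrite !rev_cons -!cats1 -catA.
have P_ba : P b * P a = low (transp F a b) * P b.
  rewrite galg_emb_transp transpC [P a]transpC transpM_left ?eq_lrshift //.
    by rewrite transpC [transp F (rshift _ _) _]transpC.
  by rewrite eq_lshift; apply: contraNneq a_t => ->; rewrite mem_head.
have comm_t : GRing.comm (low (transp F a b)) (\prod_(c <- rev t) P c).
  rewrite big_seq; apply: commr_prod => c; rewrite mem_rev => ct.
  rewrite galg_emb_transp; apply: transpM_disjoint.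
  - by rewrite eq_lshift; apply: contraNneq a_t => <-; rewrite inE ct orbT.
  - by rewrite eq_lshift; apply: contraNneq b_t => <-.
  - by rewrite eq_rlshift.
  - by rewrite eq_rlshift.
rewrite big_cat /= big_cons big_seq1 P_ba mulrA -comm_t -mulrA.
rewrite chain_cons2 rmorphM /= -mulrA -IH //; congr (_ * _).
by rewrite rev_cons -cats1 big_cat /= big_seq1.
Qed.

Lemma ptrace_prod_transp a (t : seq 'I_n) : uniq (a :: t) ->
  ptrace p (\prod_(b <- rev (a :: t)) P b) = chain F (a :: t).
Proof.
move=> Ut; apply: (galg_emb_inj (fI := @lshift_inj n 1)); rewrite ptraceE.
rewrite enum_ordSl enum_ord0 /= prod_transp_chain //.
rewrite symbol_trace_mull; last by apply/codomP=> -[b /eqP]; rewrite eq_rlshift.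
rewrite symbol_trace_basis tpermR eq_lrshift expr0 scale1r.
by rewrite /remove_symbol tpermR tpermC tperm2 galg_basis1 mulr1.
Qed.

Lemma prod_polyC_or_X (R : nzRingType) (f : 'I_n -> R) (K : {set 'I_n}) l :
  \prod_(a <- l) (if a \in K then (f a)%:P else 'X) =
    (\prod_(a <- [seq a <- l | a \in K]) f a)%:P *
      'X^(count (fun a => a \notin K) l).
Proof.
elim: l => [|a l IH]; first by rewrite !big_nil mulr1.
rewrite big_cons IH /=; case: (a \in K).
  by rewrite big_cons polyCM mulrA.
by rewrite exprS !mulrA commr_polyX.
Qed.

(** In the expanded product, K is the set of sites at which the constant term is
chosen.  The sites are multiplied in decreasing order, hence [rev]. *)
Lemma coef_prod_XaddC (R : nzRingType) (f : 'I_n -> R) k : (k <= n)%N ->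
  (\prod_(a < n) ('X + (f (rev_ord a))%:P))`_(n - k) =
    \sum_(K : {set 'I_n} | #|K| == k) \prod_(a <- rev (enum K)) f a.
Proof.
move=> le_kn; under eq_bigr => a _ do rewrite addrC.
rewrite bigA_distr coef_sum.
have preimK : involutive (fun K : {set 'I_n} => @rev_ord n @^-1: K).
  by move=> K; apply/setP=> a; rewrite !inE rev_ordK.
rewrite (reindex_inj (inv_inj preimK)) /= [RHS]big_mkcond.
apply: eq_bigr => K _.
under eq_bigr => a _ do rewrite inE.
rewrite (prod_rev_ord (fun a => if a \in K then (f a)%:P else 'X)).
rewrite prod_polyC_or_X coefCM coefXn filter_rev count_rev.
have -> : [seq a <- enum 'I_n | a \in K] = enum K by rewrite enumT.
have -> : count (fun a => a \notin K) (enum 'I_n) = (n - #|K|)%N.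
  have := count_predC (mem K) (enum 'I_n); rewrite size_enum_ord.
  by rewrite -size_filter {1}enumT -/(enum_mem _) -cardE => /(canRL (addKn _)).
have le_Kn : (#|K| <= n)%N by rewrite -[leqRHS]card_ord max_card.
have -> : (n - k == n - #|K|)%N = (#|K| == k).
  rewrite -(eqn_add2r (k + #|K|)) addnA subnK // addnCA subnK // addnC.
  exact: eqn_add2r.
by case: eqP; rewrite ?mulr1 ?mulr0.
Qed.

(** An increasing k-tuple is the same thing as its set of entries. *)
Lemma Gsum_sets k : Gsum F n k =
  \sum_(K : {set 'I_n} | #|K| == k) chain F (enum K).
Proof.
pose h (t : k.-tuple 'I_n) := [set a in t].
pose D := [set t : k.-tuple 'I_n | sorted ltn [seq val i | i <- t]].
have enum_srt (K : {set 'I_n}) : sorted ltn [seq val i | i <- enum K].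
  rewrite sorted_map; apply: sorted_filter => [? ? ?|]; first exact: ltn_trans.
  by rewrite -enumT -sorted_map val_enum_ord iota_ltn_sorted.
have enum_h t : t \in D -> enum (h t) = t.
  rewrite inE => t_srt.
  apply/(inj_map val_inj)/(irr_sorted_eq ltn_trans ltnn) => //.
  by apply: eq_mem_map => a; rewrite mem_enum inE.
have h_inj : {in D &, injective h}.
  by move=> t u tD uD htu; apply: val_inj; rewrite /= -(enum_h t tD) htu enum_h.
have h_im : [set K : {set 'I_n} | #|K| == k] = h @: D.
  apply/setP=> K; rewrite inE; apply/eqP/imsetP=> [K_k|[t tD ->]].
    have szK : size (enum K) == k by rewrite -cardE K_k.
    exists (Tuple szK); first by rewrite inE enum_srt.
    by apply/setP=> a; rewrite inE mem_enum.
  by rewrite cardE enum_h ?size_tuple.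
transitivity (\sum_(K in h @: D) chain F (enum K)).
  rewrite big_imset //; apply: eq_big => [t|t t_srt]; first by rewrite inE.
  by rewrite enum_h ?inE.
by rewrite -h_im; apply: eq_bigl => K; rewrite inE.
Qed.

Lemma Tcoef1 k : (1 <= k <= n)%N -> Tcoef n 1 k p = Gsum F n k.
Proof.
case/andP=> k_gt0 le_kn; rewrite /Tcoef /Tpoly coef_map /=.
rewrite antisymmetrizer1 theta_emb rmorph1 polyC1 mul1r.
rewrite (eq_bigr (fun a => 'X + (P (rev_ord a))%:P)) => [|a _]; last first.
  by rewrite /Tfactor big_ord1; congr (_ + (transp F _ (rshift _ _))%:P).
rewrite (coef_prod_XaddC (fun a => P a)) // raddf_sum Gsum_sets.
apply: eq_bigr => K /eqP K_k; have := enum_uniq K.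
move: K_k; rewrite cardE; case: (enum K) => [|a t].
  by move=> k0; rewrite -k0 in k_gt0.
by move=> _; apply: ptrace_prod_transp.
Qed.

End FirstTransferMatrix.

(** * Coefficients lying in a subalgebra *)

Section SubalgebraCoefficients.
Variables (F : fieldType) (aT : falgType F) (U : {aspace aT}).
Hypothesis U1 : 1 \in U.
Implicit Types x y q : {poly aT}.

Lemma coefM_mem x y k : (forall i, (i <= k)%N -> x`_i \in U) ->
  (forall i, (i <= k)%N -> y`_i \in U) -> (x * y)`_k \in U.
Proof.
move=> xU yU; rewrite coefM; apply: memv_suml => i _.
by apply: memvM; [apply/xU; rewrite -ltnS | apply/yU/leq_subr].
Qed.

Lemma coef_polyC_mem a k : a \in U -> a%:P`_k \in U.
Proof. by move=> aU; rewrite coefC; case: eqP; rewrite ?mem0v. Qed.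

Lemma coef_exp_mem x j k :
  (forall i, (i <= k)%N -> x`_i \in U) -> (x ^+ j)`_k \in U.
Proof.
elim: j k => [|j IHj] k xU; first exact: coef_polyC_mem.
rewrite exprS; apply: coefM_mem => // i le_ik.
by apply: IHj => i' /leq_trans/(_ le_ik)/xU.
Qed.

Lemma coef_shift_exp_mem j k : (('X - 1 : {poly aT}) ^+ j)`_k \in U.
Proof.
apply: coef_exp_mem => i _; rewrite coefB coefX memvB ?coef_polyC_mem //.
by case: eqP => _; rewrite ?mem0v.
Qed.

Lemma coef_comp_shift_mem x : (forall i, x`_i \in U) ->
  forall k, (x \Po ('X - 1))`_k \in U.
Proof.
move=> xU k; rewrite comp_polyE coef_sum; apply: memv_suml => i _.
by rewrite coefZ; apply: memvM; last exact: coef_shift_exp_mem.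
Qed.

(** The lowest coefficient of (u - 1)^l is a unit, so the coefficients of x are
recovered one after another. *)
Lemma shift_exp_cancel x l k :
    (forall j, (j <= k)%N -> (('X - 1) ^+ l * x)`_j \in U) -> x`_k \in U.
Proof.
have [d] := ubnP k; elim: d => // d IHd in k * => /ltnSE-le_kd xU.
have c0 : (('X - 1 : {poly aT}) ^+ l)`_0 = (-1) ^+ l.
  elim: (l) => [|l' IHl]; first by rewrite !expr0 coefC eqxx.
  by rewrite !exprS coefM big_ord1 IHl coefB coefX coefC eqxx /= sub0r.
have := xU k (leqnn k); rewrite coefM big_ord_recl subn0 c0 => sumU.
have : (-1) ^+ l * x`_k \in U.
  rewrite -(addrK (\sum_(i < k)
    (('X - 1) ^+ l)`_(lift ord0 i) * x`_(k - lift ord0 i)) (_ * _)) memvB //.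
  apply: memv_suml => i _; apply: memvM.
    exact: coef_shift_exp_mem.
  apply: IHd => [|j le_j]; last by apply: xU; rewrite (leq_trans le_j) ?leq_subr.
  by rewrite (leq_trans _ le_kd) // ltn_subrL /= (leq_ltn_trans _ (ltn_ord i)).
by rewrite -signr_odd mulr_sign; case: (odd l); rewrite ?memvN.
Qed.

Lemma log_coef_mem q k :
  (forall i, (i <= k)%N -> q`_i \in U) -> log_coef q k \in U.
Proof.
move=> qU; apply: memv_suml => j _; apply/memvZ/coef_exp_mem => i le_ik.
by rewrite coefB memvB ?qU ?coef_polyC_mem.
Qed.

(** With f = q - 1, the terms with j >= 2 of the coefficient of u^k in log q
involve only the coefficients of f below k, since f has no constant term; the
term with j = 1 is the coefficient of u^k in f itself. *)
Lemma mem_of_log_coef q K : q`_0 = 1 ->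
    (forall k, (0 < k <= K)%N -> log_coef q k \in U) ->
  forall k, (k <= K)%N -> q`_k \in U.
Proof.
move=> q0 logU k; have [d] := ubnP k.
elim: d => // d IHd in k * => /ltnSE-le_kd le_kK.
have [->|k_gt0] := posnP k; first by rewrite q0.
pose f := q - 1.
have f0 : f`_0 = 0 by rewrite coefB q0 coefC eqxx subrr.
have fU i : (i < k)%N -> f`_i \in U.
  move=> lt_ik; rewrite coefB memvB ?coef_polyC_mem //.
  by rewrite IHd ?(leq_trans lt_ik) // ltnW // (leq_trans lt_ik).
have f_high j : (f ^+ j.+2)`_k \in U.
  rewrite exprS coefM; apply: memv_suml => -[[|i] /= lt_ik] _.
    by rewrite f0 mul0r mem0v.
  have [->|i_neq] := eqVneq i.+1 k.
    by rewrite subnn exprS coefM big_ord1 f0 mul0r mulr0 mem0v.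
  apply: memvM; first by apply: fU; rewrite ltn_neqAle i_neq -ltnS.
  apply: coef_exp_mem => i' le_i'; apply: fU; apply: leq_ltn_trans le_i' _.
  by rewrite ltn_subrL.
have := logU k; rewrite k_gt0 le_kK => /(_ isT).
rewrite /log_coef big_ltn ?ltnS // big_add1 /= -/f expr1 sqrrN expr1n divr1.
rewrite scale1r => sumU; rewrite -[q](subrK 1) -/f coefD coefC memvD //.
  rewrite -(addrK (\sum_(1 <= i < k)
    ((-1) ^+ i.+2 / i.+1%:R : F) *: (f ^+ i.+1)`_k) f`_k) memvB //.
  rewrite big_seq; apply: memv_suml => i; rewrite mem_index_iota => /andP[].
  by case: i => // i _ _; apply: memvZ.
by case: eqP; rewrite ?mem0v.
Qed.

End SubalgebraCoefficients.

(** * The higher T_m are determined by T_1 *)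

Section HigherTransferMatrices.
Variables (F : fieldType) (n : nat) (p : F).
Hypothesis F_char0 : [pchar F] =i pred0.

Lemma coef_prod_XaddC_top (R : nzRingType) (I : Type) (c : I -> R) (l : seq I) k :
  (size l <= k)%N ->
  (\prod_(a <- l) ('X + (c a)%:P))`_k = (k == size l)%:R.
Proof.
elim: l k => [|a l IH] k /=; first by rewrite big_nil coefC; case: (k).
case: k => // k le_lk; rewrite big_cons mulrDl coefD coefXM /= coefCM.
by rewrite !IH ?(ltnW le_lk) // [k.+1 == size l]gtn_eqF // mulr0 addr0.
Qed.

Lemma Tpoly_coef_top m k : (n <= k)%N -> exists c, (Tpoly n m p)`_k = c%:A.
Proof.
move=> le_nk; rewrite /Tpoly coef_map /= coefCM.
rewrite prod_rev_ord coef_prod_XaddC_top size_rev size_enum_ord //.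
case: eqP => _; rewrite ?mulr1; first exact: ptrace_theta.
by exists 0; rewrite mulr0 linear0 scale0r.
Qed.

(** Induction on m by the fusion relation read modulo u^n; from degree n on the
coefficients are scalars. *)
Lemma Tpoly_mem (U : {aspace galg F n}) : 1 \in U ->
    (forall k, (1 <= k <= n)%N -> Gsum F n k \in U) ->
  forall m k, (Tpoly n m.+1 p)`_k \in U.
Proof.
move=> U1 GU.
have highU m k : (n <= k)%N -> (Tpoly n m p)`_k \in U.
  by move=> /(Tpoly_coef_top m)[c ->]; apply: memvZ.
have T1U k : (Tpoly n 1 p)`_k \in U.
  have [/highU //|lt_kn] := leqP n k.
  have nk : (1 <= n - k <= n)%N by rewrite subn_gt0 lt_kn leq_subr.
  by have := Tcoef1 p nk; rewrite /Tcoef subKn ?(ltnW lt_kn) // => ->; apply: GU.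
elim=> [|m IHm] k; first exact: T1U.
have [/highU //|lt_kn] := leqP n k.
apply: (@shift_exp_cancel _ _ U U1 _ n) => j le_jk.
have [V T_eq] := @Tpoly_fusion F n m.+1 p F_char0.
move/(congr1 (fun x : {poly galg F n} => x`_j)): T_eq.
rewrite coefD coefXnM (leq_ltn_trans le_jk lt_kn) addr0 => <-.
apply: coefM_mem => i _; first exact: T1U.
exact: coef_comp_shift_mem.
Qed.

End HigherTransferMatrices.

(** * The local charges *)

Section GeneratingSeries.
Variables (F : fieldType) (n : nat).
Hypothesis n_gt0 : (0 < n)%N.

Lemma Gsum1 : Gsum F n 1 = n%:R.
Proof.
rewrite Gsum_sets (eq_bigr (fun=> 1)) => [|K].
  rewrite (eq_bigl (fun K => K \in [set K : {set 'I_n} | #|K| == 1])) => [|K].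
    by rewrite sumr_const card_draws card_ord bin1.
  by rewrite inE.
rewrite cardE; case: (enum K) => [|a [|]] //= _; exact: chain1.
Qed.

(** As G_1 = n, the first summand of S_1 is the term k = 1 of the sum. *)
Lemma S1_poly : S1 F n = \poly_(j < n) Gsum F n (n - j).
Proof.
have -> : S1 F n = \sum_(1 <= k < n.+1) (Gsum F n k)%:P * 'X^(n - k).
  rewrite [RHS]big_ltn ?ltnS // Gsum1 subn1; congr (_ + _).
  by rewrite -mulr_natl polyC_natr.
rewrite big_add1 /= big_nat_rev big_mkord poly_def; apply: eq_bigr => j _.
by rewrite add0n -mul_polyC subnS prednK ?subn_gt0 // subKn // ltnW.
Qed.

End GeneratingSeries.

Lemma adjoin_seq_sub (F : fieldType) (aT : falgType F) (U : {aspace aT})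
    (xs : seq aT) :
  1 \in U -> {subset xs <= U} -> (<<1 & xs>> <= U)%VS.
Proof.
move=> U1 /span_subvP xsU; apply: agenv_sub_modl; first by rewrite -memvE.
by apply: prodv_sub => //; rewrite subv_add -memvE U1.
Qed.

Theorem corollary8p5 (R : realType) (n : nat) (n_ge1 : (1 <= n)%N)
    (p : R[i]) :
  bethe_algebra n p =
    <<1 & gamma R[i] n ::
          [seq local_charge R[i] n k | k <- iota 1 (n - 2)]>>%VS.
Proof.
have charC : [pchar R[i]] =i pred0 by apply: Num.Theory.pchar_num.
set bethe_gens := [seq Tcoef n m i p | m <- iota 1 n.-1, i <- iota 1 n].
set charge_gens := gamma R[i] n :: _.
apply/eqP; rewrite eqEsubv; apply/andP; split.
  pose U := <<1 & charge_gens>>%AS.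
  have U1 : 1 \in U by rewrite memvE sub1_agenv.
  have gU x : x \in charge_gens -> x \in U by apply: seqv_sub_adjoin.
  have gammaU : gamma R[i] n \in U by rewrite gU ?mem_head.
  pose q := (gamma R[i] n)^-1%:P * S1 R[i] n.
  have q_low k : (k <= n - 2)%N -> q`_k \in U.
    apply: mem_of_log_coef; rewrite ?coef0_gammaV_S1 // => {}k /andP[k_gt0 le_k].
    apply: gU; rewrite in_cons; apply/orP; right; apply: map_f.
    by rewrite mem_iota k_gt0 add1n ltnS.
  have GU k : (1 <= k <= n)%N -> Gsum R[i] n k \in U.
    case/andP=> k_gt0 le_kn; have [->|k_neq1] := eqVneq k 1.
      by rewrite Gsum1 -scaler_nat memvZ.
    (* G_k is the coefficient of u^(n-k) in gamma q, and n - k <= n - 2. *)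
    have -> : Gsum R[i] n k = gamma R[i] n * q`_(n - k).
      rewrite /q coefCM mulrA divrr ?gamma_unit // mul1r S1_poly //.
      by rewrite coef_poly ltn_subrL k_gt0 n_ge1 subKn.
    apply: memvM => //; apply: q_low; rewrite leq_sub2l //.
    by rewrite ltn_neqAle eq_sym k_neq1.
  apply: (adjoin_seq_sub (U := U)) => // x /allpairsP[[m i] /= [m_in i_in ->]].
  rewrite mem_iota in m_in; case: m m_in => // m _.
  exact: (Tpoly_mem p charC U1 GU).
pose U := <<1 & bethe_gens>>%AS.
have U1 : 1 \in U by rewrite memvE sub1_agenv.
have GU k : (1 <= k <= n)%N -> Gsum R[i] n k \in U.
  have [n1|n_gt1 k_bounds] := leqP n 1.
    case/andP=> k_gt0 le_kn.
    have -> : k = 1 by apply/eqP; rewrite eqn_leq k_gt0 (leq_trans le_kn).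
    by rewrite Gsum1 -scaler_nat memvZ.
  rewrite -(Tcoef1 p k_bounds); apply: seqv_sub_adjoin; apply/allpairsP.
  exists (1, k); rewrite /= !mem_iota !add1n ltnS k_bounds; split=> //.
  by rewrite -subn1 subn_gt0.
have gammaU : gamma R[i] n \in U by rewrite -Gsum_gamma GU ?n_ge1 ?leqnn.
apply: (adjoin_seq_sub (U := U)) => // x; rewrite inE => /predU1P[->//|].
case/mapP=> k _ ->; apply: log_coef_mem => // i _.
rewrite coefCM memvM ?memvV // S1_poly // coef_poly.
case: ifP => [lt_in|_]; last exact: mem0v.
by rewrite GU // subn_gt0 lt_in leq_subr.
Qed.
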